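(* Let $c\geqslant 3$ and let $\mathcal P$ be a $c$-oriented polyhedron with $f$ faces. Then $\mathcal P$ can be guarded by at most $$\left\lfloor \frac f2-\frac fc\right\rfloor$$ face guards; this holds both for closed face guards and for open face guards. (No assumption is made on the genus of $\mathcal P$ or on the number of its cavities.)
   Context: A polyhedron is a connected subset of $\mathbb R^3$ that is a union of finitely many closed tetrahedra and whose boundary is a (possibly non-connected) orientable 2-manifold. A face is a maximal planar subset of the boundary with connected, non-empty relative interior (a plane polygon, possibly with holes). A point $x$ is visible to a point $y$ if no point of the segment $xy$ lies in the exterior of the polyhedron; $\mathcal V(x)$ is the set of points visible to $x$, and $\mathcal V(S)=\bigcup_{x\in S}\mathcal V(x)$. A set $S$ guards the polyhedron if $\mathcal V(S)$ is the whole polyhedron (including its boundary). A closed face guard is a face including its relative boundary; an open face guard is the relative interior of a face. A set of face guards guards $\mathcal P$ if the union of the guards guards $\mathcal P$. A polyhedron is $c$-oriented if there exist $c$ unit vectors such that every face is orthogonal to one of them. *)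

(* Defs.v *)
From Stdlib Require Import Reals List.
Open Scope R_scope.

Record R3 := mkR3 { px : R; py : R; pz : R }.

Definition add3 (a b : R3) : R3 := mkR3 (px a + px b) (py a + py b) (pz a + pz b).
Definition sub3 (a b : R3) : R3 := mkR3 (px a - px b) (py a - py b) (pz a - pz b).
Definition scale3 (t : R) (a : R3) : R3 := mkR3 (t * px a) (t * py a) (t * pz a).
Definition dot3 (a b : R3) : R := px a * px b + py a * py b + pz a * pz b.
Definition norm3 (a : R3) : R := sqrt (dot3 a a).
Definition dist3 (a b : R3) : R := norm3 (sub3 a b).

Definition R2 := (R * R)%type.
Definition dist2 (u v : R2) : R :=
  sqrt ((fst u - fst v) ^ 2 + (snd u - snd v) ^ 2).

Definition open3 (U : R3 -> Prop) : Prop :=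
  forall x, U x -> exists r, 0 < r /\ forall y, dist3 x y < r -> U y.

Definition boundary (S : R3 -> Prop) (x : R3) : Prop :=
  forall r, 0 < r ->
    (exists y, dist3 x y < r /\ S y) /\ (exists y, dist3 x y < r /\ ~ S y).

Definition exterior (S : R3 -> Prop) (x : R3) : Prop :=
  exists r, 0 < r /\ forall y, dist3 x y < r -> ~ S y.

Definition closure (S : R3 -> Prop) (x : R3) : Prop :=
  forall r, 0 < r -> exists y, dist3 x y < r /\ S y.

Definition connected (S : R3 -> Prop) : Prop :=
  ~ exists U V : R3 -> Prop,
      open3 U /\ open3 V /\
      (forall x, S x -> U x \/ V x) /\
      (exists x, S x /\ U x) /\ (exists x, S x /\ V x) /\
      (forall x, S x -> U x -> V x -> False).

Definition cont_on {A B : Type} (dA : A -> A -> R) (dB : B -> B -> R)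
  (D : A -> Prop) (f : A -> B) : Prop :=
  forall x, D x -> forall eps, 0 < eps ->
    exists delta, 0 < delta /\
      forall y, D y -> dA x y < delta -> dB (f x) (f y) < eps.

Definition open_disc (u : R2) : Prop := fst u ^ 2 + snd u ^ 2 < 1.

Definition two_manifold (S : R3 -> Prop) : Prop :=
  forall x, S x -> exists U : R3 -> Prop, open3 U /\ U x /\
    exists (phi : R3 -> R2) (psi : R2 -> R3),
      (forall y, S y -> U y -> open_disc (phi y)) /\
      (forall u, open_disc u -> S (psi u) /\ U (psi u)) /\
      (forall y, S y -> U y -> psi (phi y) = y) /\
      (forall u, open_disc u -> phi (psi u) = u) /\
      cont_on dist3 dist2 (fun y => S y /\ U y) phi /\
      cont_on dist2 dist3 open_disc psi.

Definition det3 (u v w : R3) : R :=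
  px u * (py v * pz w - pz v * py w)
  - py u * (px v * pz w - pz v * px w)
  + pz u * (px v * py w - py v * px w).

Record tetra := mkTetra { ta : R3; tb : R3; tc : R3; td : R3 }.

Definition nondegenerate (T : tetra) : Prop :=
  det3 (sub3 (tb T) (ta T)) (sub3 (tc T) (ta T)) (sub3 (td T) (ta T)) <> 0.

Definition in_tetra (T : tetra) (x : R3) : Prop :=
  exists l1 l2 l3 l4 : R,
    0 <= l1 /\ 0 <= l2 /\ 0 <= l3 /\ 0 <= l4 /\ l1 + l2 + l3 + l4 = 1 /\
    x = add3 (add3 (scale3 l1 (ta T)) (scale3 l2 (tb T)))
             (add3 (scale3 l3 (tc T)) (scale3 l4 (td T))).

(* A polyhedron: connected, a finite union of closed tetrahedra, whose
   boundary is a 2-manifold (orientability is automatic). *)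
Definition is_polyhedron (P : R3 -> Prop) : Prop :=
  connected P /\
  (exists Ts : list tetra,
      (forall T, In T Ts -> nondegenerate T) /\
      (forall x, P x <-> exists T, In T Ts /\ in_tetra T x)) /\
  two_manifold (boundary P).

Definition is_plane (H : R3 -> Prop) : Prop :=
  exists (n : R3) (d : R), n <> mkR3 0 0 0 /\ forall x, H x <-> dot3 n x = d.

Definition relint (H S : R3 -> Prop) (x : R3) : Prop :=
  S x /\ exists r, 0 < r /\ forall y, H y -> dist3 x y < r -> S y.

(* candidate for a face: planar subset of the boundary with connected,
   non-empty relative interior, which is a (closed) plane polygon, i.e.
   the closure of its relative interior *)
Definition face_candidate (P F : R3 -> Prop) : Prop :=
  exists H, is_plane H /\ (forall x, F x -> H x) /\
    (forall x, F x -> boundary P x) /\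
    (exists x, relint H F x) /\ connected (relint H F) /\
    (forall x, F x <-> closure (relint H F) x).

Definition is_face (P F : R3 -> Prop) : Prop :=
  face_candidate P F /\
  forall G, face_candidate P G -> (forall x, F x -> G x) -> forall x, G x -> F x.

Definition open_face (F : R3 -> Prop) (x : R3) : Prop :=
  exists H, is_plane H /\ (forall y, F y -> H y) /\ relint H F x.

Definition same_set (A B : R3 -> Prop) : Prop := forall x, A x <-> B x.

Definition face_list (P : R3 -> Prop) (faces : list (R3 -> Prop)) : Prop :=
  (forall F, is_face P F <-> exists G, In G faces /\ same_set F G) /\
  (forall i j, (i < length faces)%nat -> (j < length faces)%nat -> i <> j ->
     ~ same_set (nth i faces (fun _ => False)) (nth j faces (fun _ => False))).

Definition c_oriented (c : nat) (P : R3 -> Prop) : Prop :=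
  exists vs : list R3, length vs = c /\
    (forall v, In v vs -> norm3 v = 1) /\
    forall F, is_face P F -> exists v, In v vs /\
      forall p q, F p -> F q -> dot3 (sub3 p q) v = 0.

Definition segment (x y z : R3) : Prop :=
  exists t, 0 <= t <= 1 /\ z = add3 x (scale3 t (sub3 y x)).

Definition visible (P : R3 -> Prop) (x y : R3) : Prop :=
  forall z, segment x y z -> ~ exterior P z.

Definition guards (P S : R3 -> Prop) : Prop :=
  forall y, P y <-> exists x, S x /\ visible P x y.

(* Main.v *)
Require Import Defs.
From Stdlib Require Import Reals List ZArith Lia Lra Classical ClassicalEpsilon.
From Coquelicot Require Compactness.
Import ListNotations.
Open Scope R_scope.

(* Averaging over the [c] normals, two of them are orthogonal to at least [2f/c] faces.
   Let [e] be orthogonal to both normals. Every point of the polyhedron sees, in the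
   direction [-e] up to an arbitrarily small perturbation, a relative interior point of a
   face having the interior of the polyhedron on its [e]-side, so these "floors" guard the
   polyhedron; by symmetry so do the "ceilings", which are the floors for [-e]. Neither kind
   of face is parallel to [e]. As the boundary is a 2-manifold, invariance of domain shows
   that near a relative interior point of a face the boundary is planar, hence that no face
   is both a floor and a ceiling, and the smaller of the two families has at most
   [(f - 2f/c) / 2] members. *)

(** * Discrete winding numbers and invariance of domain in the plane *)

(** The manifold condition is purely topological, yet the count depends on it: two boxes that meet
    along an edge, one above and one below a common plane, have coplanar faces that merge into a
    single planar set which is a floor on one half and a ceiling on the other. Excluding this
    requires that no further sheet of the boundary come near a relative interior point of a face.
    The charts are only continuous, so this needs invariance of domain, in dimension two only, where
    counting passages between quadrants along a sampled loop is enough. The perturbation is forced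
    as well: the unperturbed ray may slide along a face parallel to [e] or leave through an edge or
    a vertex. The perturbed ray leaves through a point where all supporting planes coincide, hence
    through the relative interior of a face, so that one and the same family of faces serves as
    closed and as open guards. *)

Inductive quadrant := Q0 | Q1 | Q2 | Q3.

Definition opp_quad (a : quadrant) : quadrant :=
  match a with Q0 => Q2 | Q1 => Q3 | Q2 => Q0 | Q3 => Q1 end.

Definition quad_num (a : quadrant) : Z :=
  match a with Q0 => 0 | Q1 => 1 | Q2 => 2 | Q3 => 3 end.

(** Signed number of quarter turns, the short way round. Opposite quadrants get the value [2], a
    case that [turn_square] excludes. *)
Definition turn (a b : quadrant) : Z :=
  match ((quad_num b - quad_num a) mod 4)%Z with 3%Z => (-1)%Z | d => d end.

(* Half-open quadrants, so that [quad_of] commutes with negation; the origin is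
   (arbitrarily) sent to [Q0]. *)
Definition quad_of (p : R2) : quadrant :=
  let (x, y) := p in
  if Rlt_dec 0 x then (if Rle_dec 0 y then Q0 else Q3)
  else if Rlt_dec 0 y then Q1
  else if Rlt_dec x 0 then Q2
  else if Rlt_dec y 0 then Q3 else Q0.

Fixpoint winding (f : nat -> quadrant) (n : nat) : Z :=
  match n with
  | O => 0%Z
  | S m => (winding f m + turn (f m) (f (S m)))%Z
  end.

(** Quadrants that are pairwise not opposite all lie in two adjacent ones, where [turn] is a
    difference of positions and hence additive. *)
Lemma turn_square a b c d :
  a <> opp_quad b -> a <> opp_quad c -> a <> opp_quad d ->
  b <> opp_quad c -> b <> opp_quad d -> c <> opp_quad d ->
  (turn a b + turn b d = turn a c + turn c d)%Z.
Proof.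
  destruct a, b, c, d; cbv; intros; try reflexivity; congruence.
Qed.

(** Sum of [turn_square] over the squares of a strip; the rungs between neighbouring squares
    telescope, leaving the two outer ones. *)
Lemma winding_adjacent_rows f g n :
  (forall i, (i < n)%nat ->
     f i <> opp_quad (f (S i)) /\ f i <> opp_quad (g i) /\
     f i <> opp_quad (g (S i)) /\ f (S i) <> opp_quad (g i) /\
     f (S i) <> opp_quad (g (S i)) /\ g i <> opp_quad (g (S i))) ->
  (winding f n + turn (f n) (g n) = turn (f O) (g O) + winding g n)%Z.
Proof.
  induction n as [|n IH]; intros H; cbn [winding]; [lia|].
  destruct (H n ltac:(lia)) as (h1 & h2 & h3 & h4 & h5 & h6).
  pose proof (turn_square (f n) (f (S n)) (g n) (g (S n)) h1 h2 h3 h4 h5 h6).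
  specialize (IH ltac:(intros; apply H; lia)). lia.
Qed.

Lemma winding_congr f n : exists k,
  (winding f n = quad_num (f n) - quad_num (f O) + 4 * k)%Z.
Proof.
  induction n as [|n [k IH]].
  - exists 0%Z. cbn [winding]. lia.
  - assert (E : exists j, (turn (f n) (f (S n)) =
        quad_num (f (S n)) - quad_num (f n) + 4 * j)%Z).
    { destruct (f n), (f (S n)); cbv [turn quad_num]; simpl;
        (exists 0%Z; reflexivity) || (exists 1%Z; reflexivity)
        || (exists (-1)%Z; reflexivity). }
    destruct E as [j E]. exists (k + j)%Z. cbn [winding]. lia.
Qed.

(** [opp_quad] preserves turns, so the second half of the loop repeats the first, and a half that
    ends opposite to its start has winding congruent to [2] modulo [4]. This is the discrete form of
    the fact that odd loops have odd degree. *)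
Lemma winding_antipodal f n :
  (forall i, (i <= n)%nat -> f (i + n)%nat = opp_quad (f i)) ->
  winding f (n + n) <> 0%Z.
Proof.
  intros H.
  assert (E : forall m, (m <= n)%nat ->
            (winding f (m + n) = winding f n + winding f m)%Z).
  { induction m as [|m IH]; intros Hm; cbn [winding Nat.add]; [lia|].
    rewrite IH by lia.
    replace (S (m + n)) with (S m + n)%nat by lia.
    rewrite !H by lia.
    assert (turn (opp_quad (f m)) (opp_quad (f (S m))) = turn (f m) (f (S m)))
      by (destruct (f m), (f (S m)); reflexivity). lia. }
  rewrite E by lia.
  destruct (winding_congr f n) as [k Hk].
  pose proof (H O ltac:(lia)) as H0. simpl in H0. rewrite H0 in Hk.
  destruct (f O); cbn [quad_num opp_quad] in Hk; lia.
Qed.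

Lemma winding_const a n : winding (fun _ => a) n = 0%Z.
Proof.
  induction n as [|n IH]; cbn [winding]; [reflexivity|].
  rewrite IH. destruct a; reflexivity.
Qed.

Lemma winding_ext f g n :
  (forall i, (i <= n)%nat -> f i = g i) -> winding f n = winding g n.
Proof.
  induction n as [|n IH]; intros H; cbn [winding]; [reflexivity|].
  rewrite IH, !H; auto; intros; apply H; lia.
Qed.

Lemma quad_of_neg x y : (x, y) <> (0, 0) ->
  quad_of (- x, - y) = opp_quad (quad_of (x, y)).
Proof.
  intros H. unfold quad_of.
  repeat match goal with |- context [Rlt_dec ?a ?b] => destruct (Rlt_dec a b)
    | |- context [Rle_dec ?a ?b] => destruct (Rle_dec a b) end;
  simpl; try reflexivity; try lra.
  exfalso; apply H; f_equal; lra.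
Qed.

(** A nonzero coordinate of [(a, b)] gives both points the same strict sign in that coordinate,
    which opposite half-open quadrants never share. *)
Lemma quad_of_near a b x y x' y' : (a, b) <> (0, 0) ->
  (a <> 0 -> Rabs (x - a) < Rabs a /\ Rabs (x' - a) < Rabs a) ->
  (b <> 0 -> Rabs (y - b) < Rabs b /\ Rabs (y' - b) < Rabs b) ->
  quad_of (x, y) <> opp_quad (quad_of (x', y')).
Proof.
  intros Hab Ha Hb.
  assert (C : 0 < a \/ a < 0 \/ 0 < b \/ b < 0).
  { destruct (Rtotal_order a 0) as [?|[?|?]]; try lra.
    destruct (Rtotal_order b 0) as [?|[?|?]]; try lra.
    exfalso; apply Hab; f_equal; lra. }
  assert (D : (0 < x /\ 0 < x') \/ (x < 0 /\ x' < 0) \/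
              (0 < y /\ 0 < y') \/ (y < 0 /\ y' < 0)).
  { destruct C as [C|[C|[C|C]]].
    1,2: destruct (Ha ltac:(lra)) as [h1 h2].
    3,4: destruct (Hb ltac:(lra)) as [h1 h2].
    all: revert h1 h2; unfold Rabs; repeat destruct Rcase_abs; intros; lra. }
  unfold quad_of.
  repeat match goal with |- context [Rlt_dec ?a ?b] => destruct (Rlt_dec a b)
    | |- context [Rle_dec ?a ?b] => destruct (Rle_dec a b) end;
  simpl; try discriminate; lra.
Qed.

Definition unit_interval (t : R) : Prop := 0 <= t <= 1.

Definition square_continuous (G : R -> R -> R2) : Prop :=
  forall s t, unit_interval s -> unit_interval t -> forall eps, 0 < eps ->
  exists delta, 0 < delta /\ forall s' t', unit_interval s' -> unit_interval t' ->
    Rabs (s' - s) < delta -> Rabs (t' - t) < delta ->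
    Rabs (fst (G s' t') - fst (G s t)) < eps /\
    Rabs (snd (G s' t') - snd (G s t)) < eps.

(** Locally this is [quad_of_near]; compactness of the square makes the radius uniform, like a
    Lebesgue number. *)
Lemma uniform_quadrants G :
  square_continuous G ->
  (forall s t, unit_interval s -> unit_interval t -> G s t <> (0, 0)) ->
  exists d, 0 < d /\ forall s t s' t',
    unit_interval s -> unit_interval t -> unit_interval s' -> unit_interval t' ->
    Rabs (s' - s) < d -> Rabs (t' - t) < d ->
    quad_of (G s t) <> opp_quad (quad_of (G s' t')).
Proof.
  intros GC G0.
  assert (L : forall s t, exists delta : posreal,
    unit_interval s -> unit_interval t ->
    forall s1 t1 s2 t2, unit_interval s1 -> unit_interval t1 ->
      unit_interval s2 -> unit_interval t2 ->
      Rabs (s1 - s) < 2 * delta -> Rabs (t1 - t) < 2 * delta ->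
      Rabs (s2 - s) < 2 * delta -> Rabs (t2 - t) < 2 * delta ->
      quad_of (G s1 t1) <> opp_quad (quad_of (G s2 t2))).
  { intros s t.
    destruct (classic (unit_interval s /\ unit_interval t)) as [[Hs Ht]|N].
    2: { exists (mkposreal 1 Rlt_0_1). tauto. }
    pose proof (G0 s t Hs Ht) as NZ.
    destruct (G s t) as [a b] eqn:E.
    assert (exists eps, 0 < eps /\ (a <> 0 -> eps <= Rabs a) /\ (b <> 0 -> eps <= Rabs b))
      as (eps & He & Ea & Eb).
    { destruct (Req_dec a 0) as [Za|Za], (Req_dec b 0) as [Zb|Zb].
      - exists 1; lra.
      - exists (Rabs b). split; [now apply Rabs_pos_lt|]. split; lra.
      - exists (Rabs a). split; [now apply Rabs_pos_lt|]. split; lra.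
      - exists (Rmin (Rabs a) (Rabs b)). split.
        + apply Rmin_glb_lt; now apply Rabs_pos_lt.
        + split; intros _; [apply Rmin_l|apply Rmin_r]. }
    destruct (GC s t Hs Ht eps He) as (d & Hd & HG).
    (* Halving leaves room for a second point within [delta] of a point that is itself within
       [delta] of the centre. *)
    assert (Hd2 : 0 < d / 2) by lra.
    exists (mkposreal _ Hd2). simpl. intros _ _ s1 t1 s2 t2 I1 I2 I3 I4 D1 D2 D3 D4.
    destruct (HG s1 t1 I1 I2) as [A1 A2]; try lra.
    destruct (HG s2 t2 I3 I4) as [A3 A4]; try lra.
    rewrite E in *. simpl in *.
    destruct (G s1 t1), (G s2 t2). simpl in *.
    apply (quad_of_near a b); auto; intros; split; intuition lra. }
  pose (delta s t := proj1_sig (constructive_indefinite_description _ (L s t))).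
  destruct (Compactness.compactness_value_2d 0 1 0 1 delta) as [d Hd].
  exists d. split; [apply cond_pos|].
  intros s t s' t' Is It Is' It' Ds Dt Bad.
  (* Compactness yields the centre [(u, v)] only under a double negation, which is enough because
     the goal is [False]. *)
  apply (Hd s t Is It). intros (u & v & Iu & Iv & Du & Dv & Le).
  revert Bad. unfold delta in *.
  destruct (constructive_indefinite_description _ (L u v)) as [dl Hdl]; simpl in *.
  assert (0 < dl) by apply cond_pos.
  apply Hdl; auto; try lra.
  - replace (s' - u) with ((s' - s) + (s - u)) by ring.
    eapply Rle_lt_trans; [apply Rabs_triang|lra].
  - replace (t' - v) with ((t' - t) + (t - v)) by ring.
    eapply Rle_lt_trans; [apply Rabs_triang|lra].
Qed.

(** No limit in [n] is taken: invariance is stated for all large [n], and a single [n] then serves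
    all the homotopies. *)
Definition loop_winding (g : R -> R2) (n : nat) : Z :=
  winding (fun i => quad_of (g (INR i / INR n))) n.

Lemma frac_unit i n : (i <= n)%nat -> (0 < n)%nat -> unit_interval (INR i / INR n).
Proof.
  intros H Hn. apply le_INR in H. apply lt_INR in Hn. simpl in Hn.
  split.
  - apply Rmult_le_pos; [apply pos_INR|]. left. now apply Rinv_0_lt_compat.
  - apply Rmult_le_reg_r with (INR n); [lra|].
    unfold Rdiv. rewrite Rmult_assoc, Rinv_l by lra. lra.
Qed.

Lemma frac_step i n d : (0 < n)%nat -> / INR n < d ->
  Rabs (INR (S i) / INR n - INR i / INR n) < d /\
  Rabs (INR i / INR n - INR (S i) / INR n) < d.
Proof.
  intros Hn H. apply lt_INR in Hn; simpl in Hn.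
  assert (E : INR (S i) / INR n - INR i / INR n = / INR n)
    by (rewrite S_INR; field; lra).
  assert (0 < / INR n) by now apply Rinv_0_lt_compat.
  rewrite (Rabs_minus_sym (INR i / INR n)), E, Rabs_right by lra. lra.
Qed.

(** On a grid finer than the uniform radius, consecutive rows satisfy [winding_adjacent_rows]; the
    two outer rungs of each strip agree because the loops are closed, so they cancel. *)
Lemma loop_winding_homotopy G :
  square_continuous G ->
  (forall s t, unit_interval s -> unit_interval t -> G s t <> (0, 0)) ->
  (forall t, unit_interval t -> G 0 t = G 1 t) ->
  exists N, forall n, (N < n)%nat ->
    loop_winding (fun s => G s 0) n = loop_winding (fun s => G s 1) n.
Proof.
  intros GC G0 GL.
  destruct (uniform_quadrants G GC G0) as (d & Hd & U).
  assert (exists N, forall n, (N < n)%nat -> / INR n < d) as [N HN].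
  { destruct (archimed_cor1 d Hd) as (N & H1 & H2). exists N. intros n Hn.
    eapply Rle_lt_trans; [|exact H1].
    apply Rinv_le_contravar; [now apply (lt_INR 0)|apply le_INR; lia]. }
  exists N. intros n Hn. specialize (HN n Hn).
  assert (Pn : (0 < n)%nat) by lia.
  assert (Pr : 0 < INR n) by now apply (lt_INR 0).
  pose (row j i := quad_of (G (INR i / INR n) (INR j / INR n))).
  assert (St : forall j, (j < n)%nat -> winding (row j) n = winding (row (S j)) n).
  { intros j Hj.
    assert (A := winding_adjacent_rows (row j) (row (S j)) n).
    assert (Z0 : forall k, (k <= n)%nat -> row k n = row k O).
    { intros k Hk. unfold row. replace (INR n / INR n) with 1 by (field; lra).
      replace (INR 0 / INR n) with 0 by (simpl; field; lra).
      now rewrite GL by (apply frac_unit; lia). }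
    rewrite !Z0 in A by lia.
    enough (winding (row j) n + turn (row j O) (row (S j) O) =
            turn (row j O) (row (S j) O) + winding (row (S j)) n)%Z by lia.
    apply A. intros i Hi. unfold row.
    destruct (frac_step i n d Pn HN) as [F1 F2].
    destruct (frac_step j n d Pn HN) as [F3 F4].
    assert (forall z, Rabs (z - z) < d) by (intros; rewrite Rminus_diag, Rabs_R0; lra).
    repeat split; apply U; try apply frac_unit; auto; lia. }
  assert (R0 : forall j, (j <= n)%nat -> winding (row O) n = winding (row j) n).
  { induction j as [|j IH]; intros Hj; [reflexivity|].
    rewrite IH by lia. apply St; lia. }
  unfold loop_winding.
  transitivity (winding (row O) n).
  { apply winding_ext. intros. unfold row.
    now replace (INR 0 / INR n) with 0 by (simpl; field; lra). }
  rewrite (R0 n) by lia.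
  apply winding_ext. intros. unfold row.
  now replace (INR n / INR n) with 1 by (field; lra).
Qed.

(** * Continuity calculus for functions on the unit square *)

Definition square_continuous_real (f : R -> R -> R) : Prop :=
  forall s t, unit_interval s -> unit_interval t -> forall eps, 0 < eps ->
  exists delta, 0 < delta /\ forall s' t', unit_interval s' -> unit_interval t' ->
    Rabs (s' - s) < delta -> Rabs (t' - t) < delta -> Rabs (f s' t' - f s t) < eps.

Lemma sqc_const c : square_continuous_real (fun _ _ => c).
Proof.
  intros s t _ _ eps He. exists 1. split; [lra|]. intros.
  now rewrite Rminus_diag, Rabs_R0.
Qed.

Lemma sqc_snd : square_continuous_real (fun _ t => t).
Proof. intros s t _ _ eps He. exists eps. split; auto. Qed.

Lemma sqc_fst_comp g : continuity g -> square_continuous_real (fun s _ => g s).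
Proof.
  intros C s t _ _ eps He. destruct (C s eps He) as (d & Hd & H).
  exists d. split; [exact Hd|]. intros s' t' _ _ D _.
  destruct (Req_dec s s') as [<-|N]; [now rewrite Rminus_diag, Rabs_R0|].
  apply H. split; [split; [exact I|exact N]|exact D].
Qed.

Lemma sqc_plus f g : square_continuous_real f -> square_continuous_real g ->
  square_continuous_real (fun s t => f s t + g s t).
Proof.
  intros F G s t Is It eps He.
  destruct (F s t Is It (eps / 2) ltac:(lra)) as (d & Hd & HF).
  destruct (G s t Is It (eps / 2) ltac:(lra)) as (d' & Hd' & HG).
  exists (Rmin d d'). split; [now apply Rmin_glb_lt|]. intros s' t' Is' It' Ds Dt.
  pose proof (Rmin_l d d'). pose proof (Rmin_r d d').
  specialize (HF s' t' Is' It' ltac:(lra) ltac:(lra)).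
  specialize (HG s' t' Is' It' ltac:(lra) ltac:(lra)).
  replace (f s' t' + g s' t' - (f s t + g s t))
    with ((f s' t' - f s t) + (g s' t' - g s t)) by ring.
  eapply Rle_lt_trans; [apply Rabs_triang|lra].
Qed.

Lemma sqc_mult f g : square_continuous_real f -> square_continuous_real g ->
  square_continuous_real (fun s t => f s t * g s t).
Proof.
  intros F G s t Is It eps He.
  set (a := f s t). set (b := g s t).
  pose proof (Rabs_pos a) as Pa. pose proof (Rabs_pos b) as Pb.
  (* The three error terms below are at most [eps / K] times [1], [Rabs b] and [Rabs a], in sum
     [eps / 2]. *)
  set (K := 2 * (Rabs a + Rabs b + 1)).
  assert (0 < eps / K) by (apply Rdiv_lt_0_compat; unfold K; lra).
  assert (EK : eps / K * K = eps) by (field; unfold K; lra).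
  assert (He' : 0 < Rmin 1 (eps / K)) by (apply Rmin_glb_lt; lra).
  destruct (F s t Is It _ He') as (d & Hd & HF).
  destruct (G s t Is It _ He') as (d' & Hd' & HG).
  exists (Rmin d d'). split; [now apply Rmin_glb_lt|]. intros s' t' Is' It' Ds Dt.
  pose proof (Rmin_l d d'). pose proof (Rmin_r d d').
  specialize (HF s' t' Is' It' ltac:(lra) ltac:(lra)). fold a in HF.
  specialize (HG s' t' Is' It' ltac:(lra) ltac:(lra)). fold b in HG.
  fold a b. set (x := f s' t') in *. set (y := g s' t') in *.
  pose proof (Rmin_l 1 (eps / K)). pose proof (Rmin_r 1 (eps / K)).
  replace (x * y - a * b) with ((x - a) * (y - b) + (x - a) * b + a * (y - b)) by ring.
  eapply Rle_lt_trans; [apply Rabs_triang|].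
  eapply Rle_lt_trans; [apply Rplus_le_compat_r, Rabs_triang|].
  rewrite !Rabs_mult.
  pose proof (Rabs_pos (x - a)). pose proof (Rabs_pos (y - b)).
  assert (Rabs (x - a) * Rabs (y - b) <= Rabs (x - a) * 1)
    by (apply Rmult_le_compat_l; lra).
  assert (Rabs (x - a) * Rabs b <= eps / K * Rabs b)
    by (apply Rmult_le_compat_r; lra).
  assert (Rabs a * Rabs (y - b) <= Rabs a * (eps / K))
    by (apply Rmult_le_compat_l; lra).
  unfold K in EK at 2. nra.
Qed.

Lemma square_continuous_intro G :
  square_continuous_real (fun s t => fst (G s t)) ->
  square_continuous_real (fun s t => snd (G s t)) -> square_continuous G.
Proof.
  intros F1 F2 s t Is It eps He.
  destruct (F1 s t Is It eps He) as (d & Hd & H1).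
  destruct (F2 s t Is It eps He) as (d' & Hd' & H2).
  exists (Rmin d d'). split; [now apply Rmin_glb_lt|]. intros s' t' Is' It' Ds Dt.
  pose proof (Rmin_l d d'). pose proof (Rmin_r d d').
  split; [apply H1|apply H2]; auto; lra.
Qed.

Lemma dist2_lt u v r : 0 < r -> Rabs (fst u - fst v) < r / 2 ->
  Rabs (snd u - snd v) < r / 2 -> dist2 u v < r.
Proof.
  intros Hr H1 H2. unfold dist2. rewrite <- (sqrt_Rsqr r) by lra.
  apply sqrt_lt_1_alt. unfold Rsqr.
  set (x := fst u - fst v) in *. set (y := snd u - snd v) in *.
  split; [nra|]. apply Rabs_def2 in H1, H2. nra.
Qed.

Lemma dist2_coord u v :
  Rabs (fst u - fst v) <= dist2 u v /\ Rabs (snd u - snd v) <= dist2 u v.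
Proof.
  unfold dist2.
  set (x := fst u - fst v). set (y := snd u - snd v).
  pose proof (pow2_ge_0 x). pose proof (pow2_ge_0 y).
  split; rewrite <- sqrt_Rsqr_abs; apply sqrt_le_1_alt; unfold Rsqr; lra.
Qed.

Definition closed_disc (u : R2) : Prop := fst u ^ 2 + snd u ^ 2 <= 1.

Lemma sqc_comp_disc h a b :
  cont_on dist2 dist2 closed_disc h ->
  square_continuous_real a -> square_continuous_real b ->
  (forall s t, unit_interval s -> unit_interval t -> closed_disc (a s t, b s t)) ->
  square_continuous_real (fun s t => fst (h (a s t, b s t))) /\
  square_continuous_real (fun s t => snd (h (a s t, b s t))).
Proof.
  intros C A B D.
  assert (forall s t, unit_interval s -> unit_interval t -> forall eps, 0 < eps ->
    exists delta, 0 < delta /\ forall s' t', unit_interval s' -> unit_interval t' ->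
    Rabs (s' - s) < delta -> Rabs (t' - t) < delta ->
    dist2 (h (a s' t', b s' t')) (h (a s t, b s t)) < eps) as M.
  { intros s t Is It eps He.
    destruct (C _ (D s t Is It) eps He) as (r & Hr & H).
    destruct (A s t Is It (r / 2) ltac:(lra)) as (d & Hd & H1).
    destruct (B s t Is It (r / 2) ltac:(lra)) as (d' & Hd' & H2).
    exists (Rmin d d'). split; [now apply Rmin_glb_lt|]. intros s' t' Is' It' Ds Dt.
    pose proof (Rmin_l d d'). pose proof (Rmin_r d d').
    specialize (H1 s' t' Is' It' ltac:(lra) ltac:(lra)).
    specialize (H2 s' t' Is' It' ltac:(lra) ltac:(lra)).
    replace (dist2 (h (a s' t', b s' t')) (h (a s t, b s t)))
      with (dist2 (h (a s t, b s t)) (h (a s' t', b s' t')))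
      by (unfold dist2; f_equal; ring).
    apply H; [now apply D|]. apply dist2_lt; simpl; auto;
      now rewrite Rabs_minus_sym. }
  split; intros s t Is It eps He;
    destruct (M s t Is It eps He) as (d & Hd & H); exists d; split; auto;
    intros s' t' Is' It' Ds Dt; eapply Rle_lt_trans; try apply (H s' t'); auto;
    apply dist2_coord.
Qed.

(** * Polar coordinates with signed radius, and the three homotopies of the disc *)

Definition circle (s : R) : R2 := (cos (2 * PI * s), sin (2 * PI * s)).
Definition polar (s r : R) : R2 := (r * fst (circle s), r * snd (circle s)).

Lemma polar_disc s r : -1 <= r <= 1 -> closed_disc (polar s r).
Proof.
  intros H. unfold closed_disc, polar, circle. simpl.
  pose proof (sin2_cos2 (2 * PI * s)) as E. unfold Rsqr in E.
  set (x := cos _) in *. set (y := sin _) in *.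
  replace (r * x * (r * x * 1) + r * y * (r * y * 1)) with (r * r * (y * y + x * x)) by ring.
  rewrite E. nra.
Qed.

Lemma polar_inj s r r' : polar s r = polar s r' -> r = r'.
Proof.
  unfold polar, circle. simpl. intros E. injection E as E1 E2.
  pose proof (sin2_cos2 (2 * PI * s)) as E. unfold Rsqr in E.
  set (x := cos _) in *. set (y := sin _) in *.
  assert (H : (r - r') * (y * y + x * x) = y * (r * y - r' * y) + x * (r * x - r' * x)) by ring.
  rewrite E, E1, E2 in H. lra.
Qed.

Lemma polar_half s r : polar (s + / 2) r = polar s (- r).
Proof.
  unfold polar, circle. simpl.
  replace (2 * PI * (s + / 2)) with (2 * PI * s + PI) by field.
  rewrite neg_cos, neg_sin. f_equal; ring.
Qed.

Lemma polar_closed r : polar 0 r = polar 1 r.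
Proof.
  unfold polar, circle. simpl.
  rewrite Rmult_0_r, Rmult_1_r, cos_0, sin_0, cos_2PI, sin_2PI. reflexivity.
Qed.

Lemma polar_0 s : polar s 0 = (0, 0).
Proof. unfold polar. f_equal; ring. Qed.

Lemma circle_continuous :
  continuity (fun s => fst (circle s)) /\ continuity (fun s => snd (circle s)).
Proof.
  split; unfold circle; simpl; intros s; reg.
Qed.

Lemma sqc_polar h r : cont_on dist2 dist2 closed_disc h ->
  square_continuous_real (fun _ t => r t) ->
  (forall t, unit_interval t -> -1 <= r t <= 1) ->
  square_continuous_real (fun s t => fst (h (polar s (r t)))) /\
  square_continuous_real (fun s t => snd (h (polar s (r t)))).
Proof.
  intros C Cr Hr. destruct circle_continuous as [C1 C2].
  apply (sqc_comp_disc h (fun s t => r t * fst (circle s)) (fun s t => r t * snd (circle s))); auto.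
  - apply sqc_mult; [exact Cr|]. now apply sqc_fst_comp.
  - apply sqc_mult; [exact Cr|]. now apply sqc_fst_comp.
  - intros s t Is It. apply (polar_disc s (r t)). auto.
Qed.

(** Injectivity keeps the image of the circle off [h (0,0)], and the squared distance attains its
    minimum on the compact parameter interval. *)
Lemma circle_image_away h :
  cont_on dist2 dist2 closed_disc h ->
  (forall u v, closed_disc u -> closed_disc v -> h u = h v -> u = v) ->
  exists d, 0 < d /\ forall s, unit_interval s ->
    d <= (fst (h (polar s 1)) - fst (h (0,0))) ^ 2 + (snd (h (polar s 1)) - snd (h (0,0))) ^ 2.
Proof.
  intros C Inj.
  (* Clamping extends the function continuously to the whole line, since the extreme value theorem
     asks for two-sided continuity at the end points too. *)
  pose (clamp s := Rmax 0 (Rmin 1 s)).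
  assert (Cl : forall s, unit_interval (clamp s)).
  { intros s. unfold clamp, unit_interval, Rmax, Rmin. repeat destruct Rle_dec; lra. }
  assert (Cl2 : forall s, unit_interval s -> clamp s = s).
  { intros s [? ?]. unfold clamp, Rmax, Rmin. repeat destruct Rle_dec; lra. }
  destruct (sqc_polar h (fun _ => 1) C (sqc_const 1) ltac:(intros; lra)) as [F1 F2].
  pose (f := fun s t : R => (fst (h (polar s 1)) + - fst (h (0,0))) * (fst (h (polar s 1)) + - fst (h (0,0)))
    + (snd (h (polar s 1)) + - snd (h (0,0))) * (snd (h (polar s 1)) + - snd (h (0,0)))).
  assert (F : square_continuous_real f).
  { unfold f. apply sqc_plus; apply sqc_mult; apply sqc_plus; auto using sqc_const. }
  assert (K : forall s, 0 <= s <= 1 -> continuity_pt (fun s => f (clamp s) 0) s).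
  { intros s _ eps He.
    destruct (F (clamp s) 0 (Cl s) ltac:(unfold unit_interval; lra) eps He) as (d & Hd & H).
    exists d. split; [exact Hd|]. intros s' [_ D]. simpl in *. unfold Rdist in *.
    apply H; auto; try (unfold unit_interval; lra).
    - eapply Rle_lt_trans; [|exact D]. unfold clamp, Rmax, Rmin.
      repeat destruct Rle_dec; unfold Rabs; repeat destruct Rcase_abs; lra.
    - now rewrite Rminus_diag, Rabs_R0. }
  destruct (continuity_ab_min _ 0 1 ltac:(lra) K) as (m & Hm & Im).
  exists (f m 0). split.
  - unfold f.
    assert (h (polar m 1) <> h (0,0)) as N.
    { intros E. apply Inj in E.
      - rewrite <- (polar_0 m) in E. apply polar_inj in E. lra.
      - apply polar_disc; lra.
      - unfold closed_disc; simpl; lra. }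
    destruct (h (polar m 1)) as [a b], (h (0,0)) as [a' b']. simpl.
    destruct (Req_dec a a') as [->|Na].
    + destruct (Req_dec b b') as [->|Nb]; [tauto|].
      assert (b + - b' <> 0) by lra. pose proof (Rsqr_pos_lt _ H). pose proof (Rle_0_sqr (a' + - a')). unfold Rsqr in *. lra.
    + assert (a + - a' <> 0) by lra. pose proof (Rsqr_pos_lt _ H). pose proof (Rle_0_sqr (b + - b')). unfold Rsqr in *. lra.
  - intros s Is. specialize (Hm s Is). rewrite (Cl2 m Im), (Cl2 s Is) in Hm.
    eapply Rle_trans; [exact Hm|]. unfold f. right; ring.
Qed.

Definition sub2 (u v : R2) : R2 := (fst u + - fst v, snd u + - snd v).

Lemma sub2_eq0 u v : sub2 u v = (0, 0) -> u = v.
Proof.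
  destruct u, v; unfold sub2; simpl; intros E; injection E; intros; f_equal; lra.
Qed.

(* If [w] near [h 0] were not attained, the loop [h - w] on the unit circle would be
   contractible in the punctured plane; but it is homotopic to [h - h 0], and then,
   by injectivity of [h], to the antipodal loop [z |-> h (z/2) - h (-z/2)]. *)
Lemma invariance_of_domain h :
  cont_on dist2 dist2 closed_disc h ->
  (forall u v, closed_disc u -> closed_disc v -> h u = h v -> u = v) ->
  exists d, 0 < d /\ forall w, dist2 (h (0, 0)) w < d ->
    exists u, closed_disc u /\ h u = w.
Proof.
  intros C Inj.
  destruct (circle_image_away h C Inj) as (d & Hd & Away).
  exists (sqrt d). split; [now apply sqrt_lt_R0|]. intros w Hw.
  apply NNPP. intros N.
  assert (Nw : forall u, closed_disc u -> h u <> w) by (intros u Du E; apply N; eauto).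
  clear N.
  assert (Half : forall t, unit_interval t -> -1 <= 1 + - (/ 2) * t <= 1 /\ -1 <= - (/ 2) * t <= 1)
    by (unfold unit_interval; intros; lra).
  pose (GA s t := sub2 (h (polar s t)) w).
  pose (GB s t := sub2 (h (polar s 1)) (fst w + t * (fst (h (0,0)) + - fst w),
                                        snd w + t * (snd (h (0,0)) + - snd w))).
  (* The two radii always differ by [1], so injectivity keeps [GC] off the origin; at [t = 1] they
     are opposite, which makes the loop odd. *)
  pose (GC s t := sub2 (h (polar s (1 + - (/ 2) * t))) (h (polar s (- (/ 2) * t)))).
  assert (Op : forall f, square_continuous_real f -> square_continuous_real (fun s t => - f s t)).
  { intros f F s t Is It eps He. destruct (F s t Is It eps He) as (r & Hr & H).
    exists r; split; auto. intros.
    replace (- f s' t' - - f s t) with (- (f s' t' - f s t)) by ring.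
    rewrite Rabs_Ropp. auto. }
  destruct (loop_winding_homotopy GA) as [NA HA].
  { destruct (sqc_polar h (fun t => t) C sqc_snd) as [F1 F2];
      [unfold unit_interval; intros; lra|].
    apply square_continuous_intro; unfold GA, sub2; simpl;
      apply sqc_plus; auto using sqc_const. }
  { intros s t Is It E. apply sub2_eq0 in E. revert E. apply Nw, polar_disc.
    destruct It; lra. }
  { intros t _. unfold GA. now rewrite polar_closed. }
  destruct (loop_winding_homotopy GB) as [NB HB].
  { destruct (sqc_polar h (fun _ => 1) C (sqc_const 1)) as [F1 F2]; [intros; lra|].
    apply square_continuous_intro; unfold GB, sub2; simpl;
      (apply sqc_plus; [assumption|]);
      apply Op, sqc_plus; try apply sqc_mult; auto using sqc_const, sqc_snd. }
  (* The moving base point stays closer than [sqrt d] to [h (0,0)], while the image of the circle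
     does not come that close. *)
  { intros s t Is [It1 It2] E. apply sub2_eq0 in E. specialize (Away s Is).
    rewrite E in Away. simpl in Away. unfold dist2 in Hw. apply sqrt_lt_0_alt in Hw.
    destruct (h (0,0)) as [p q], w as [x y]. simpl in *.
    replace ((x + t * (p + - x) - p) * ((x + t * (p + - x) - p) * 1) +
      (y + t * (q + - y) - q) * ((y + t * (q + - y) - q) * 1))
      with ((1 - t) * (1 - t) * ((p - x) * ((p - x) * 1) + (q - y) * ((q - y) * 1))) in Away by ring.
    assert (0 <= (1 - t) * (1 - t) <= 1) by nra.
    set (X := (p - x) * ((p - x) * 1) + (q - y) * ((q - y) * 1)) in *.
    assert (0 <= X) by (unfold X; clear; pose proof (pow2_ge_0 (p - x)); pose proof (pow2_ge_0 (q - y)); lra).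
    nra. }
  { intros t _. unfold GB. now rewrite polar_closed. }
  destruct (loop_winding_homotopy GC) as [NC HC].
  { destruct (sqc_polar h (fun t => 1 + - (/ 2) * t) C) as [F1 F2].
    { apply sqc_plus; [|apply sqc_mult]; auto using sqc_const, sqc_snd. }
    { intros t It. now apply Half. }
    destruct (sqc_polar h (fun t => - (/ 2) * t) C) as [F3 F4].
    { apply sqc_mult; auto using sqc_const, sqc_snd. }
    { intros t It. now apply Half. }
    apply square_continuous_intro; unfold GC, sub2; simpl; apply sqc_plus; auto. }
  { intros s t Is It E. apply sub2_eq0, Inj in E; try (apply polar_disc; now apply Half).
    apply polar_inj in E. lra. }
  { intros t _. unfold GC. now rewrite !polar_closed. }
  set (n := (S (NA + NB + NC))%nat).
  assert (Pn : 0 < INR n) by (apply (lt_INR 0); lia).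
  specialize (HA (n + n)%nat ltac:(lia)). specialize (HB (n + n)%nat ltac:(lia)).
  specialize (HC (n + n)%nat ltac:(lia)).
  assert (E1 : loop_winding (fun s => GA s 1) (n + n) = loop_winding (fun s => GB s 0) (n + n)).
  { apply winding_ext. intros i _. unfold GA, GB. do 2 f_equal. destruct w; simpl. f_equal; ring. }
  assert (E2 : loop_winding (fun s => GB s 1) (n + n) = loop_winding (fun s => GC s 0) (n + n)).
  { apply winding_ext. intros i _. unfold GC, GB. rewrite !Rmult_0_r, Rplus_0_r, polar_0.
    do 2 f_equal. destruct w, (h (0,0)); simpl. f_equal; ring. }
  assert (E3 : loop_winding (fun s => GA s 0) (n + n) = 0%Z).
  { etransitivity; [|apply (winding_const (quad_of (sub2 (h (0, 0)) w)) (n + n))].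
    apply winding_ext. intros i _. unfold GA. now rewrite polar_0. }
  (* With an even number of samples, the antipode of sample [i] is sample [i + n]. *)
  apply (winding_antipodal (fun i => quad_of (GC (INR i / INR (n + n)) 1)) n).
  2: { unfold loop_winding in *. congruence. }
  intros i Hi.
  replace (INR (i + n) / INR (n + n)) with (INR i / INR (n + n) + / 2)
    by (rewrite !plus_INR; field; lra).
  unfold GC. set (s := INR i / INR (n + n)).
  assert (Is : unit_interval s) by (apply frac_unit; lia).
  rewrite !Rmult_1_r, !polar_half.
  replace (1 + - / 2) with (/ 2) by lra. rewrite Ropp_involutive.
  unfold sub2. rewrite <- quad_of_neg.
  - do 2 f_equal; ring.
  - intros E. apply sub2_eq0, Inj in E; try (apply polar_disc; lra).
    apply polar_inj in E. lra.
Qed.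

(** * Affine functionals and polyhedra as unions of cells *)

Definition zero3 : R3 := mkR3 0 0 0.

Ltac vec := unfold dist3, sub3, add3, scale3, dot3, zero3 in *; simpl in *.

Lemma R3_ext a b : px a = px b -> py a = py b -> pz a = pz b -> a = b.
Proof. destruct a, b; simpl; congruence. Qed.

Lemma dot3_self_pos a : a <> zero3 -> 0 < dot3 a a.
Proof.
  intros H. destruct a as [x y z]. unfold dot3; simpl.
  pose proof (Rle_0_sqr x) as A; pose proof (Rle_0_sqr y) as B; pose proof (Rle_0_sqr z) as C.
  unfold Rsqr in *.
  destruct (Req_dec x 0) as [->|N]; [|pose proof (Rsqr_pos_lt x N); unfold Rsqr in *; lra].
  destruct (Req_dec y 0) as [->|N]; [|pose proof (Rsqr_pos_lt y N); unfold Rsqr in *; lra].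
  destruct (Req_dec z 0) as [->|N]; [|pose proof (Rsqr_pos_lt z N); unfold Rsqr in *; lra].
  now destruct H.
Qed.

Lemma dot3_self_nonneg a : 0 <= dot3 a a.
Proof. destruct a; unfold dot3; simpl; nra. Qed.

Lemma norm3_nonneg a : 0 <= norm3 a.
Proof. apply sqrt_pos. Qed.

Lemma norm3_sq a : norm3 a * norm3 a = dot3 a a.
Proof. apply sqrt_sqrt, dot3_self_nonneg. Qed.

Lemma norm3_scale t a : norm3 (scale3 t a) = Rabs t * norm3 a.
Proof.
  unfold norm3. rewrite <- sqrt_Rsqr_abs, <- sqrt_mult.
  - f_equal. destruct a; vec; unfold Rsqr; ring.
  - apply Rle_0_sqr.
  - apply dot3_self_nonneg.
Qed.

Lemma cauchy_schwarz a b : Rabs (dot3 a b) <= norm3 a * norm3 b.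
Proof.
  unfold norm3. rewrite <- sqrt_mult by apply dot3_self_nonneg.
  rewrite <- sqrt_Rsqr_abs. apply sqrt_le_1_alt.
  destruct a as [x y z], b as [u v w]. unfold dot3, Rsqr; simpl.
  pose proof (pow2_ge_0 (x * v - y * u)). pose proof (pow2_ge_0 (x * w - z * u)).
  pose proof (pow2_ge_0 (y * w - z * v)). nra.
Qed.

Lemma norm3_triangle a b : norm3 (add3 a b) <= norm3 a + norm3 b.
Proof.
  apply Rsqr_incr_0_var; [|pose proof (norm3_nonneg a); pose proof (norm3_nonneg b); lra].
  unfold Rsqr. rewrite norm3_sq.
  pose proof (cauchy_schwarz a b) as C. pose proof (Rle_abs (dot3 a b)).
  replace (dot3 (add3 a b) (add3 a b)) with (dot3 a a + 2 * dot3 a b + dot3 b b)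
    by (vec; ring).
  rewrite <- !norm3_sq. nra.
Qed.

Lemma dist3_sym x y : dist3 x y = dist3 y x.
Proof. unfold dist3, norm3. f_equal. vec; ring. Qed.

Lemma dist3_triangle x y z : dist3 x z <= dist3 x y + dist3 y z.
Proof.
  unfold dist3. eapply Rle_trans; [|apply norm3_triangle].
  right. f_equal. vec. f_equal; ring.
Qed.

Lemma dist3_refl x : dist3 x x = 0.
Proof.
  unfold dist3, norm3. replace (dot3 _ _) with 0 by (vec; ring). apply sqrt_0.
Qed.

Lemma dist3_add x v : dist3 x (add3 x v) = norm3 v.
Proof. unfold dist3, norm3. f_equal. vec; ring. Qed.

Lemma dist3_ray x v t : dist3 x (add3 x (scale3 t v)) = Rabs t * norm3 v.
Proof. now rewrite dist3_add, norm3_scale. Qed.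

Lemma small_scale v r : 0 < r ->
  exists d, 0 < d /\ forall t, Rabs t <= d -> Rabs t * norm3 v < r.
Proof.
  intros Hr. pose proof (norm3_nonneg v).
  exists (r / (norm3 v + 1)). split; [apply Rdiv_lt_0_compat; lra|].
  intros t Ht. pose proof (Rabs_pos t).
  apply Rle_lt_trans with (r / (norm3 v + 1) * norm3 v).
  - apply Rmult_le_compat_r; lra.
  - apply Rmult_lt_reg_r with (norm3 v + 1); [lra|].
    replace (r / (norm3 v + 1) * norm3 v * (norm3 v + 1)) with (r * norm3 v) by (field; lra).
    nra.
Qed.

Definition lerp (p q : R3) (t : R) : R3 := add3 p (scale3 t (sub3 q p)).

Lemma dist3_lerp y p q t r : 0 <= t <= 1 -> dist3 y p < r -> dist3 y q < r ->
  dist3 y (lerp p q t) < r.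
Proof.
  intros Ht Hp Hq. unfold dist3 in *.
  replace (sub3 y (lerp p q t))
    with (add3 (scale3 (1 - t) (sub3 y p)) (scale3 t (sub3 y q)))
    by (unfold lerp; apply R3_ext; vec; ring).
  eapply Rle_lt_trans; [apply norm3_triangle|].
  rewrite !norm3_scale, !Rabs_pos_eq by lra.
  destruct (Req_dec t 0) as [->|N]; [lra|].
  assert (t * norm3 (sub3 y q) < t * r) by (apply Rmult_lt_compat_l; lra).
  assert ((1 - t) * norm3 (sub3 y p) <= (1 - t) * r) by (apply Rmult_le_compat_l; lra).
  lra.
Qed.

Lemma dist3_lerp_lerp p q t s :
  dist3 (lerp p q t) (lerp p q s) = Rabs (s - t) * norm3 (sub3 q p).
Proof.
  rewrite <- norm3_scale. rewrite <- (dist3_add (lerp p q t)).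
  f_equal. unfold lerp. apply R3_ext; vec; ring.
Qed.

Definition affine := (R3 * R)%type.
Definition eval (f : affine) (x : R3) : R := dot3 (fst f) x + snd f.

Lemma eval_add f x v : eval f (add3 x v) = eval f x + dot3 (fst f) v.
Proof. unfold eval. vec; ring. Qed.

Lemma dot3_scale_r a t v : dot3 a (scale3 t v) = t * dot3 a v.
Proof. vec; ring. Qed.

Lemma dot3_scale_l a t v : dot3 (scale3 t a) v = t * dot3 a v.
Proof. vec; ring. Qed.

Lemma eval_lerp f p q t :
  eval f (lerp p q t) = (1 - t) * eval f p + t * eval f q.
Proof. unfold eval, lerp. vec; ring. Qed.

Lemma eval_near f y eps : 0 < eps ->
  exists r, 0 < r /\ forall z, dist3 y z < r -> Rabs (eval f z - eval f y) < eps.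
Proof.
  intros He. set (K := norm3 (fst f)). pose proof (norm3_nonneg (fst f)) as HK. fold K in HK.
  exists (eps / (K + 1)). split; [apply Rdiv_lt_0_compat; lra|].
  intros z Hz.
  replace (eval f z - eval f y) with (dot3 (fst f) (sub3 z y)) by (unfold eval; vec; ring).
  eapply Rle_lt_trans; [apply cauchy_schwarz|]. fold K.
  rewrite dist3_sym in Hz. unfold dist3 in Hz.
  pose proof (norm3_nonneg (sub3 z y)).
  apply Rle_lt_trans with (K * (eps / (K + 1))); [apply Rmult_le_compat_l; lra|].
  apply Rmult_lt_reg_r with (K + 1); [lra|].
  replace (K * (eps / (K + 1)) * (K + 1)) with (K * eps) by (field; lra). nra.
Qed.

Lemma eval_sign_near f y : eval f y <> 0 ->
  exists r, 0 < r /\ forall z, dist3 y z < r -> 0 < eval f z * eval f y.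
Proof.
  intros H. destruct (eval_near f y (Rabs (eval f y)) (Rabs_pos_lt _ H)) as (r & Hr & N).
  exists r. split; [exact Hr|]. intros z Hz. specialize (N z Hz).
  revert N. unfold Rabs. repeat destruct Rcase_abs; intros; nra.
Qed.

Lemma common_radius {A} (l : list A) (Q : A -> R -> Prop) :
  (forall a r r', Q a r -> 0 < r' <= r -> Q a r') ->
  (forall a, In a l -> exists r, 0 < r /\ Q a r) ->
  exists r, 0 < r /\ forall a, In a l -> Q a r.
Proof.
  intros Mono. induction l as [|a l IH]; intros H.
  - exists 1. split; [lra|]. intros a [].
  - destruct IH as (r & Hr & IH); [intros; apply H; simpl; auto|].
    destruct (H a ltac:(simpl; auto)) as (r' & Hr' & Ha).
    pose proof (Rmin_l r r'). pose proof (Rmin_r r r').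
    assert (0 < Rmin r r') by (apply Rmin_glb_lt; lra).
    exists (Rmin r r'). split; [lra|].
    intros b [<-|Hb]; [apply Mono with r'|apply Mono with r]; auto; lra.
Qed.

(** Leave one hyperplane at a time, by a step along its normal. The induction is strengthened to a
    whole ball around [w], so that later steps do not fall back into hyperplanes already left. *)
Lemma generic_vector (l : list R3) c r : 0 < r ->
  exists w, dist3 c w < r /\ forall a, In a l -> a <> zero3 -> dot3 a w <> 0.
Proof.
  intros Hr.
  enough (exists w r', 0 < r' /\ dist3 c w < r /\
    forall z, dist3 w z < r' -> forall a, In a l -> a <> zero3 -> dot3 a z <> 0) as (w & r' & Hr' & Hw & E).
  { exists w. split; [exact Hw|]. apply E. rewrite dist3_refl. exact Hr'. }
  induction l as [|a l IH].
  { exists c, 1. split; [lra|]. split; [now rewrite dist3_refl|]. intros z _ a []. }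
  destruct IH as (w & r' & Hr' & Hw & E).
  destruct (classic (a = zero3)) as [Za|Na0].
  { exists w, r'. repeat split; auto. intros z Hz b [<-|Hb]; [tauto|]. now apply E. }
  assert (exists w', dist3 w w' < Rmin r' (r - dist3 c w) /\ dot3 a w' <> 0) as (w' & D & Na).
  { assert (Pm : 0 < Rmin r' (r - dist3 c w)) by (apply Rmin_glb_lt; lra).
    destruct (Req_dec (dot3 a w) 0) as [Z|NZ].
    - destruct (small_scale a _ Pm) as (d & Hd & S).
      exists (add3 w (scale3 d a)). rewrite dist3_ray. split.
      + apply S. rewrite Rabs_pos_eq; lra.
      + replace (dot3 a (add3 w (scale3 d a))) with (dot3 a w + d * dot3 a a) by (vec; ring).
        pose proof (dot3_self_pos a Na0). nra.
    - exists w. rewrite dist3_refl. auto. }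
  pose proof (Rmin_l r' (r - dist3 c w)). pose proof (Rmin_r r' (r - dist3 c w)).
  assert (Ev : eval (a, 0) w' <> 0) by (unfold eval; simpl; lra).
  destruct (eval_sign_near (a, 0) w' Ev) as (r2 & Hr2 & S).
  exists w', (Rmin r2 (r' - dist3 w w')).
  pose proof (Rmin_l r2 (r' - dist3 w w')). pose proof (Rmin_r r2 (r' - dist3 w w')).
  split; [apply Rmin_glb_lt; lra|]. split.
  { pose proof (dist3_triangle c w w'). lra. }
  intros z Hz b [<-|Hb] Nb.
  - specialize (S z ltac:(lra)). intros Z. unfold eval in S. simpl in S. rewrite Z in S. lra.
  - apply (E z); auto. pose proof (dist3_triangle w w' z). lra.
Qed.

(** All that the ray argument needs of tetrahedra: membership in [P] depends only on the signs of
    finitely many affine functions. The strict points [c] supply directions into the interior, and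
    the bounds [M] force rays to leave [P]. *)
Definition cells_of (P : R3 -> Prop) (Cs : list (list affine)) : Prop :=
  (forall x, P x <-> exists C, In C Cs /\ forall f, In f C -> 0 <= eval f x) /\
  (forall C f, In C Cs -> In f C -> fst f <> zero3) /\
  (forall C, In C Cs -> exists c, forall f, In f C -> 0 < eval f c) /\
  (forall v, exists M, forall x, P x -> dot3 v x <= M).

Definition cross3 (v w : R3) : R3 :=
  mkR3 (py v * pz w - pz v * py w) (pz v * px w - px v * pz w) (px v * py w - py v * px w).

(** Cramer's rule: the scaled cross products form the basis dual to [u], [v], [w]. *)
Lemma cramer u v w y : det3 u v w <> 0 ->
  y = add3 (scale3 (dot3 (scale3 (/ det3 u v w) (cross3 v w)) y) u)
        (add3 (scale3 (dot3 (scale3 (/ det3 u v w) (cross3 w u)) y) v)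
           (scale3 (dot3 (scale3 (/ det3 u v w) (cross3 u v)) y) w)).
Proof.
  intros H. destruct u, v, w, y. unfold det3 in *.
  apply R3_ext; unfold dot3, cross3, scale3, add3; simpl in *; field; exact H.
Qed.

(** The functionals are the barycentric coordinates: three from the basis dual to the edges at [a],
    and [f1] as one minus their sum. The centroid is the strict point. *)
Lemma tetra_cell T : nondegenerate T -> exists C : list affine,
  (forall x, in_tetra T x <-> forall f, In f C -> 0 <= eval f x) /\
  (forall f, In f C -> fst f <> zero3) /\
  (exists c, forall f, In f C -> 0 < eval f c).
Proof.
  destruct T as [a b c d]. unfold nondegenerate, in_tetra. simpl.
  set (u := sub3 b a). set (v := sub3 c a). set (w := sub3 d a).
  set (D := det3 u v w). intros HD.
  pose (n2 := scale3 (/ D) (cross3 v w)). pose (n3 := scale3 (/ D) (cross3 w u)).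
  pose (n4 := scale3 (/ D) (cross3 u v)).
  pose (n1 := scale3 (-1) (add3 n2 (add3 n3 n4))).
  pose (bary n := (n, - dot3 n a) : affine).
  pose (f1 := (n1, 1 - dot3 n1 a) : affine).
  assert (E2 : dot3 n2 u = 1 /\ dot3 n2 v = 0 /\ dot3 n2 w = 0).
  { unfold n2. rewrite !dot3_scale_l. replace (dot3 (cross3 v w) u) with D
      by (unfold D, det3, dot3, cross3; simpl; ring).
    unfold dot3, cross3; simpl. repeat split; try ring. now field. }
  assert (E3 : dot3 n3 u = 0 /\ dot3 n3 v = 1 /\ dot3 n3 w = 0).
  { unfold n3. rewrite !dot3_scale_l. replace (dot3 (cross3 w u) v) with D
      by (unfold D, det3, dot3, cross3; simpl; ring).
    unfold dot3, cross3; simpl. repeat split; try ring. now field. }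
  assert (E4 : dot3 n4 u = 0 /\ dot3 n4 v = 0 /\ dot3 n4 w = 1).
  { unfold n4. rewrite !dot3_scale_l. replace (dot3 (cross3 u v) w) with D
      by (unfold D, det3, dot3, cross3; simpl; ring).
    unfold dot3, cross3; simpl. repeat split; try ring. now field. }
  assert (Z : forall n z k, dot3 n z = k -> k <> 0 -> n <> zero3).
  { intros n z k E N ->. apply N. rewrite <- E. vec. ring. }
  assert (Comb : forall n l1 l2 l3 l4, l1 + l2 + l3 + l4 = 1 ->
     dot3 n (sub3 (add3 (add3 (scale3 l1 a) (scale3 l2 b))
                (add3 (scale3 l3 c) (scale3 l4 d))) a)
     = l2 * dot3 n u + l3 * dot3 n v + l4 * dot3 n w).
  { intros n l1 l2 l3 l4 S. replace l1 with (1 - l2 - l3 - l4) by lra.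
    unfold u, v, w. vec. ring. }
  assert (Ev : forall n x, eval (bary n) x = dot3 n (sub3 x a)).
  { intros. unfold eval, bary. vec. ring. }
  assert (Ev1 : forall x, eval f1 x = 1 - dot3 n2 (sub3 x a) - dot3 n3 (sub3 x a) - dot3 n4 (sub3 x a)).
  { intros. unfold eval, f1, n1. clearbody n2 n3 n4. vec. ring. }
  destruct E2 as (E21 & E22 & E23), E3 as (E31 & E32 & E33), E4 as (E41 & E42 & E43).
  exists [f1; bary n2; bary n3; bary n4]. split; [|split].
  - intros x. split.
    + intros (l1 & l2 & l3 & l4 & P1 & P2 & P3 & P4 & S & ->) f Hf.
      simpl in Hf. destruct Hf as [<-|[<-|[<-|[<-|[]]]]];
        rewrite ?Ev1, ?Ev, !Comb by exact S;
        rewrite ?E21, ?E22, ?E23, ?E31, ?E32, ?E33, ?E41, ?E42, ?E43; lra.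
    + intros H.
      pose proof (H f1 ltac:(simpl; auto)) as H1. rewrite Ev1 in H1.
      pose proof (H (bary n2) ltac:(simpl; auto)) as H2. rewrite Ev in H2.
      pose proof (H (bary n3) ltac:(simpl; auto)) as H3. rewrite Ev in H3.
      pose proof (H (bary n4) ltac:(simpl; auto)) as H4. rewrite Ev in H4.
      exists (1 - dot3 n2 (sub3 x a) - dot3 n3 (sub3 x a) - dot3 n4 (sub3 x a)),
        (dot3 n2 (sub3 x a)), (dot3 n3 (sub3 x a)), (dot3 n4 (sub3 x a)).
      repeat (split; [assumption|]). split; [ring|].
      clear - HD. set (y := sub3 x a).
      assert (Cr : y = add3 (scale3 (dot3 n2 y) u)
                       (add3 (scale3 (dot3 n3 y) v) (scale3 (dot3 n4 y) w))).
      { apply cramer. exact HD. }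
      replace x with (add3 a y) by (unfold y; apply R3_ext; vec; ring).
      rewrite Cr at 1. generalize (dot3 n2 y) (dot3 n3 y) (dot3 n4 y). intros p q r.
      unfold u, v, w. apply R3_ext; vec; ring.
  - intros f Hf. simpl in Hf. destruct Hf as [<-|[<-|[<-|[<-|[]]]]]; simpl.
    + apply (Z n1 u (-1)); [|lra]. unfold n1.
      replace (dot3 (scale3 (-1) (add3 n2 (add3 n3 n4))) u)
        with (- (dot3 n2 u + dot3 n3 u + dot3 n4 u)) by (clear; clearbody n2 n3 n4; vec; ring).
      lra.
    + apply (Z n2 u 1); lra.
    + apply (Z n3 v 1); lra.
    + apply (Z n4 w 1); lra.
  - exists (add3 (add3 (scale3 (/ 4) a) (scale3 (/ 4) b))
                (add3 (scale3 (/ 4) c) (scale3 (/ 4) d))).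
    intros f Hf. simpl in Hf. destruct Hf as [<-|[<-|[<-|[<-|[]]]]];
        rewrite ?Ev1, ?Ev, !Comb by lra;
        rewrite ?E21, ?E22, ?E23, ?E31, ?E32, ?E33, ?E41, ?E42, ?E43; lra.
Qed.

Lemma tetra_bounded T v : exists M, forall x, in_tetra T x -> dot3 v x <= M.
Proof.
  destruct T as [a b c d]. unfold in_tetra. simpl.
  exists (Rabs (dot3 v a) + Rabs (dot3 v b) + Rabs (dot3 v c) + Rabs (dot3 v d)).
  intros x (l1 & l2 & l3 & l4 & P1 & P2 & P3 & P4 & S & ->).
  replace (dot3 v _) with (l1 * dot3 v a + l2 * dot3 v b + l3 * dot3 v c + l4 * dot3 v d)
    by (vec; ring).
  assert (A : forall l k, 0 <= l <= 1 -> l * k <= Rabs k).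
  { intros l k Hl. pose proof (Rle_abs k). pose proof (Rabs_pos k). nra. }
  pose proof (A l1 (dot3 v a) ltac:(lra)). pose proof (A l2 (dot3 v b) ltac:(lra)).
  pose proof (A l3 (dot3 v c) ltac:(lra)). pose proof (A l4 (dot3 v d) ltac:(lra)). lra.
Qed.

Lemma tetras_cells Ts : (forall T, In T Ts -> nondegenerate T) ->
  exists Cs, cells_of (fun x => exists T, In T Ts /\ in_tetra T x) Cs.
Proof.
  induction Ts as [|T Ts IH]; intros H.
  - exists []. split; [|split; [|split]].
    + intros x; split; intros (? & [] & _).
    + intros C f [].
    + intros C [].
    + intros v. exists 0. intros x (? & [] & _).
  - destruct IH as (Cs & I1 & I2 & I3 & I4); [intros; apply H; simpl; auto|].
    destruct (tetra_cell T (H T (or_introl eq_refl))) as (C & H1 & H2 & H3).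
    exists (C :: Cs). split; [|split; [|split]].
    + intros x. split.
      * intros (T' & [<-|HT] & Hx).
        -- exists C. split; [now left|]. now apply H1.
        -- destruct (proj1 (I1 x)) as (C' & HC & E); [eauto|].
           exists C'. split; [now right|exact E].
      * intros (C' & [<-|HC] & E).
        -- exists T. split; [now left|]. now apply H1.
        -- destruct (proj2 (I1 x)) as (T' & HT & E'); [eauto|].
           exists T'. split; [now right|exact E'].
    + intros C' f [<-|HC]; eauto.
    + intros C' [<-|HC]; eauto.
    + intros v. destruct (tetra_bounded T v) as (M & HM), (I4 v) as (M' & HM').
      exists (Rmax M M'). intros x (T' & [<-|HT] & Hx).
      * eapply Rle_trans; [apply HM|apply Rmax_l]; auto.
      * eapply Rle_trans; [apply HM'; eauto|apply Rmax_r].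
Qed.

Lemma polyhedron_cells P : is_polyhedron P -> exists Cs, cells_of P Cs.
Proof.
  intros (_ & (Ts & HT & HP) & _).
  destruct (tetras_cells Ts HT) as (Cs & I1 & I2 & I3 & I4).
  exists Cs. split; [|split; [|split]]; auto.
  - intros x. rewrite HP. apply I1.
  - intros v. destruct (I4 v) as (M & HM). exists M. intros x Hx. apply HM, HP, Hx.
Qed.

(** Each of the finitely many cells rejects [x] by a strict inequality, which persists nearby. *)
Lemma cells_closed P Cs x : cells_of P Cs -> ~ P x ->
  exists r, 0 < r /\ forall y, dist3 x y < r -> ~ P y.
Proof.
  intros (I1 & _) N.
  destruct (common_radius Cs (fun C r => forall y, dist3 x y < r ->
              ~ forall f, In f C -> 0 <= eval f y)) as (r & Hr & H).
  - intros C r r' H Hr' y Hy. apply H. lra.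
  - intros C HC.
    assert (exists f, In f C /\ eval f x < 0) as (f & Hf & Nf).
    { apply NNPP. intros E. apply N, I1. exists C. split; [exact HC|].
      intros f Hf. apply Rnot_lt_le. intros L. apply E. eauto. }
    destruct (eval_sign_near f x ltac:(lra)) as (r & Hr & S).
    exists r. split; [exact Hr|]. intros y Hy A.
    specialize (S y Hy). specialize (A f Hf). nra.
  - exists r. split; [exact Hr|]. intros y Hy HP. apply I1 in HP.
    destruct HP as (C & HC & E). exact (H C HC y Hy E).
Qed.

(** * Visibility along a direction *)

Definition line_at (g : R * R) (t : R) : R := fst g + t * snd g.

(** The sign is strict only for [t > 0]: supporting planes may pass through the starting point [x],
    where the value vanishes. *)
Definition steady_sign (t0 : R) (g : R * R) : Prop :=
  (0 <= fst g /\ forall t, 0 < t <= t0 -> 0 < line_at g t) \/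
  (fst g <= 0 /\ forall t, 0 < t <= t0 -> line_at g t < 0) \/
  g = (0, 0).

Lemma steady_sign_exists (l : list (R * R)) :
  exists t0, 0 < t0 <= 1 /\ forall g, In g l -> steady_sign t0 g.
Proof.
  destruct (common_radius l (fun g t0 => steady_sign t0 g)) as (r & Hr & H).
  - intros g r r' [[A B]|[[A B]|A]] Hr; [left|right; left|right; right]; auto;
      split; auto; intros; apply B; lra.
  - intros [a b] _. unfold steady_sign, line_at; simpl.
    assert (K : forall a b : R, 0 < a -> exists r, 0 < r /\ forall t, 0 < t <= r -> 0 < a + t * b).
    { clear. intros a b Ha. pose proof (Rabs_pos b).
      exists (a / (Rabs b + 1)). split; [apply Rdiv_lt_0_compat; lra|].
      intros t [Ht1 Ht2].
      assert (t * (Rabs b + 1) <= a).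
      { apply Rmult_le_compat_r with (r := Rabs b + 1) in Ht2; [|lra].
        unfold Rdiv in Ht2. rewrite Rmult_assoc, Rinv_l in Ht2; lra. }
      pose proof (Rle_abs (- b)). rewrite Rabs_Ropp in *. nra. }
    destruct (Rtotal_order a 0) as [Ha|[->|Ha]].
    + destruct (K (- a) (- b) ltac:(lra)) as (r & Hr & E).
      exists r. split; [exact Hr|]. right; left. split; [lra|].
      intros t Ht. specialize (E t Ht). nra.
    + exists 1. split; [lra|].
      destruct (Rtotal_order b 0) as [Hb|[->|Hb]].
      * right; left. split; [lra|]. intros; nra.
      * now right; right.
      * left. split; [lra|]. intros; nra.
    + destruct (K a b Ha) as (r & Hr & E). exists r. split; [exact Hr|]. left. split; [lra|auto].
  - exists (Rmin r 1). pose proof (Rmin_l r 1). pose proof (Rmin_r r 1).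
    assert (0 < Rmin r 1) by (apply Rmin_glb_lt; lra).
    split; [lra|]. intros g Hg. destruct (H g Hg) as [[A B]|[[A B]|A]];
      [left|right; left|right; right]; auto; split; auto; intros; apply B; lra.
Qed.

(** Two equally ordered finite families cut the line into corresponding gaps, so every position
    among the first has a counterpart among the second. It will carry heights on the ray over [t] to
    heights on the ray over [t0]. *)
Lemma transfer_position (l : list (R * R)) s :
  (forall p q, In p l -> In q l -> (fst p < fst q <-> snd p < snd q)) ->
  exists s', forall p, In p l ->
    (fst p < s <-> snd p < s') /\ (s < fst p <-> s' < snd p).
Proof.
  intros H.
  destruct (classic (exists p, In p l /\ fst p = s)) as [(p & Hp & <-)|N].
  { exists (snd p). intros q Hq. split; apply H; auto. }
  assert (E : forall p, In p l -> fst p <> s) by (intros p Hp Ep; apply N; eauto).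
  clear N.
  enough (exists s', forall p, In p l ->
    (fst p < s -> snd p < s') /\ (s < fst p -> s' < snd p)) as (s' & Hs).
  { exists s'. intros p Hp. destruct (Hs p Hp). pose proof (E p Hp).
    destruct (Rtotal_order (fst p) s) as [?|[?|?]]; intuition lra. }
  induction l as [|p l IH]; [exists 0; intros p []|].
  destruct IH as (s1 & H1).
  { intros; apply H; simpl; auto. }
  { intros; apply E; simpl; auto. }
  pose proof (E p (or_introl eq_refl)) as Ep.
  destruct (Rtotal_order (fst p) s) as [L|[?|G]]; [|tauto|].
  - destruct (Rlt_dec (snd p) s1) as [Lp|Gp].
    { exists s1. intros q [<-|Hq]; [split; intros; lra|auto]. }
    destruct (common_radius l (fun q r => s < fst q -> snd p + r <= snd q)) as (r & Hr & C).
    + intros q r r' A B D. specialize (A D). lra.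
    + intros q Hq. destruct (Rlt_dec s (fst q)) as [S|S].
      * exists (snd q - snd p).
        assert (snd p < snd q) by (apply H; simpl; auto; lra). split; intros; lra.
      * exists 1. split; [lra|tauto].
    + exists (snd p + r / 2). intros q [<-|Hq]; [split; intros; lra|].
      destruct (H1 q Hq). split; intros A.
      * specialize (H0 A). lra.
      * specialize (C q Hq A). lra.
  - destruct (Rlt_dec s1 (snd p)) as [Lp|Gp].
    { exists s1. intros q [<-|Hq]; [split; intros; lra|auto]. }
    destruct (common_radius l (fun q r => fst q < s -> snd q + r <= snd p)) as (r & Hr & C).
    + intros q r r' A B D. specialize (A D). lra.
    + intros q Hq. destruct (Rlt_dec (fst q) s) as [S|S].
      * exists (snd p - snd q).
        assert (snd q < snd p) by (apply H; simpl; auto; lra). split; intros; lra.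
      * exists 1. split; [lra|tauto].
    + exists (snd p - r / 2). intros q [<-|Hq]; [split; intros; lra|].
      destruct (H1 q Hq). split; intros A.
      * specialize (C q Hq A). lra.
      * specialize (H2 A). lra.
Qed.

Lemma cells_same_signs P Cs x y : cells_of P Cs ->
  (forall f, In f (concat Cs) -> 0 <= eval f x -> 0 <= eval f y) -> P x -> P y.
Proof.
  intros (I1 & _) H Hx. apply I1 in Hx. destruct Hx as (C & HC & E).
  apply I1. exists C. split; [exact HC|]. intros f Hf. apply H; auto.
  apply in_concat. eauto.
Qed.

(** [n] is an inward normal. Nothing is asked of the points on the plane itself. *)
Definition one_sided (P : R3 -> Prop) (n : R3) (y : R3) (r : R) : Prop :=
  0 < r /\ forall z, dist3 y z < r ->
    (dot3 n y < dot3 n z -> P z) /\ (dot3 n z < dot3 n y -> ~ P z).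

(* The direction [w] avoids finitely many hyperplanes, so that for small [t] the line
   from [x + t w] in direction [-e] meets the supporting planes in an order independent
   of [t]; hence the whole triangle swept lerp [x] and the exit point lies in [P]. *)
Lemma sees_below P Cs e x : cells_of P Cs -> e <> zero3 -> P x ->
  exists n y r, 0 < dot3 n e /\ one_sided P n y r /\ P y /\ (forall z, segment x y z -> P z).
Proof.
  intros HPC He Hx. pose proof HPC as (I1 & I2 & I3 & I4).
  destruct (proj1 (I1 x) Hx) as (C & HC & HxC).
  destruct (I3 C HC) as (c & Hc).
  set (L := concat Cs).
  pose (k (f : affine) := dot3 (fst f) e : R).
  (* Scaled to have product [1] with [e], which gives parallel planes the same [nv] whatever their
     orientation; meaningful where [k f] is nonzero. *)
  pose (nv (f : affine) := scale3 (/ k f) (fst f) : R3).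
  assert (exists rho, 0 < rho /\ forall f, In f C -> forall z, dist3 c z < rho -> 0 < eval f z)
    as (rho & Hrho & Int).
  { apply (common_radius C (fun f r => forall z, dist3 c z < r -> 0 < eval f z)).
    - intros f r r' A B z Hz. apply A. lra.
    - intros f Hf. pose proof (Hc f Hf) as Pf.
      destruct (eval_sign_near f c ltac:(lra)) as (r & Hr & S).
      exists r. split; [exact Hr|]. intros z Hz. specialize (S z Hz). nra. }
  (* [w] is near [c - x], so [x + w] is interior to the cell [C]. Avoiding the normals keeps
     [x + t w] off every supporting plane for small [t > 0]; avoiding the differences of the [nv]
     makes planes that are not parallel have heights with different slopes in [t]. *)
  destruct (generic_vector (map fst L ++
      flat_map (fun f => map (fun g => sub3 (nv f) (nv g)) L) L) (sub3 c x) rho Hrho)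
    as (w & Dw & Gen).
  assert (Gen1 : forall f, In f L -> dot3 (fst f) w <> 0).
  { intros f Hf. apply Gen.
    - apply in_or_app. left. now apply in_map.
    - apply in_concat in Hf. destruct Hf as (C' & H1 & H2). eapply I2; eauto. }
  assert (Gen2 : forall f g, In f L -> In g L -> nv f <> nv g -> dot3 (sub3 (nv f) (nv g)) w <> 0).
  { intros f g Hf Hg N. apply Gen.
    - apply in_or_app. right. apply in_flat_map. exists f. split; auto.
      apply in_map_iff. eauto.
    - intros Z. apply N. apply R3_ext; revert Z; destruct (nv f), (nv g); unfold sub3, zero3;
        simpl; intros Z; injection Z; intros; lra. }
  clear Gen.
  (* As a function of [t], the height [s] at which the ray from [x + t w] in direction [- e] meets
     the plane of [f]. *)
  pose (h (f : affine) := (eval f x / k f, dot3 (nv f) w) : R * R).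
  (* The entry [(0, 0)] stands for the start of the ray, so that heights are also compared with
     [0]. *)
  pose (GL := (0, 0) :: map h L).
  destruct (steady_sign_exists (map (fun f : affine => (eval f x, dot3 (fst f) w)) L ++
    flat_map (fun g => map (fun g' => (fst g - fst g', snd g - snd g')) GL) GL))
    as (t0 & Ht0 & Steady).
  assert (S1 : forall f, In f L -> steady_sign t0 (eval f x, dot3 (fst f) w)).
  { intros f Hf. apply Steady, in_or_app. left.
    now apply (in_map (fun f : affine => (eval f x, dot3 (fst f) w))). }
  assert (S2 : forall g g', In g GL -> In g' GL -> steady_sign t0 (fst g - fst g', snd g - snd g')).
  { intros g g' Hg Hg'. apply Steady, in_or_app. right.
    apply in_flat_map. exists g. split; [exact Hg|]. apply in_map_iff. eauto. }
  clear Steady.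
  pose (p t s := add3 (add3 x (scale3 t w)) (scale3 (- s) e)).
  assert (Ep : forall f t s, eval f (p t s) = line_at (eval f x, dot3 (fst f) w) t - s * k f).
  { intros. unfold p, line_at, k. rewrite !eval_add, !dot3_scale_r. simpl. ring. }
  assert (Epn : forall f t s, k f <> 0 -> eval f (p t s) = k f * (line_at (h f) t - s)).
  { intros f t s Hk. rewrite Ep. unfold line_at, h, nv. simpl. rewrite dot3_scale_l. field. exact Hk. }
  assert (Nz : forall f t, In f L -> 0 < t <= t0 -> line_at (eval f x, dot3 (fst f) w) t <> 0).
  { intros f t Hf Ht Z. destruct (S1 f Hf) as [[_ A]|[[_ A]|A]].
    - specialize (A t Ht). lra.
    - specialize (A t Ht). lra.
    - injection A as _ A. exact (Gen1 f Hf A). }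
  assert (InG : forall f, In f L -> In (h f) GL) by (intros; right; now apply in_map).
  pose (Q s := P (p t0 s)).
  assert (Q0 : Q 0).
  { apply I1. exists C. split; [exact HC|]. intros f Hf.
    replace (p t0 0) with (lerp x (add3 x w) t0)
      by (unfold lerp, p; apply R3_ext; vec; ring).
    rewrite eval_lerp.
    assert (0 < eval f (add3 x w)).
    { apply (Int f Hf). unfold dist3 in *.
      replace (sub3 c (add3 x w)) with (sub3 (sub3 c x) w) by (apply R3_ext; vec; ring).
      exact Dw. }
    specialize (HxC f Hf). nra. }
  (* [s0] is how far the ray from [x + t0 w] stays in [P], finite since [P] is bounded in direction
     [- e]. *)
  destruct (completeness (fun s => 0 <= s /\ forall s', 0 <= s' <= s -> Q s')) as (s0 & Ub & Lub).
  { destruct (I4 (scale3 (-1) e)) as (M & HM).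
    pose proof (dot3_self_pos e He) as Pe.
    exists ((M + dot3 e (add3 x (scale3 t0 w))) / dot3 e e).
    intros s (Hs & A). specialize (HM _ (A s ltac:(lra))).
    replace (dot3 (scale3 (-1) e) (p t0 s))
      with (s * dot3 e e - dot3 e (add3 x (scale3 t0 w))) in HM by (unfold p; vec; ring).
    apply Rmult_le_reg_r with (dot3 e e); [exact Pe|].
    unfold Rdiv. rewrite Rmult_assoc, Rinv_l by lra. lra. }
  { exists 0. split; [lra|]. intros s' Hs'. now replace s' with 0 by lra. }
  assert (Hs0 : 0 <= s0).
  { apply Ub. split; [lra|]. intros s' Hs'. now replace s' with 0 by lra. }
  assert (Qlt : forall s, 0 <= s < s0 -> Q s).
  { intros s Hs. apply NNPP. intros N.
    assert (s0 <= s); [|lra]. apply Lub. intros s1 (H1 & A).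
    apply Rnot_lt_le. intros Lt. apply N, A. lra. }
  assert (Dp : forall s s', dist3 (p t0 s) (p t0 s') = Rabs (s - s') * norm3 e).
  { intros s s'. rewrite <- norm3_scale, <- (dist3_add (p t0 s)). f_equal.
    unfold p. apply R3_ext; vec; ring. }
  assert (Qs0 : Q s0).
  { destruct (Req_dec s0 0) as [->|N0]; [exact Q0|]. apply NNPP. intros N.
    destruct (cells_closed P Cs _ HPC N) as (r & Hr & A).
    destruct (small_scale e r Hr) as (d & Hd & Sm).
    pose proof (Rmin_l d s0). pose proof (Rmin_r d s0).
    assert (0 < Rmin d s0) by (apply Rmin_glb_lt; lra).
    apply (A (p t0 (s0 - Rmin d s0))); [|apply Qlt; lra].
    rewrite Dp. apply Sm. rewrite Rabs_pos_eq; lra. }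
  assert (Exit : forall eta, 0 < eta -> exists s, s0 < s < s0 + eta /\ ~ Q s).
  { intros eta Heta. apply NNPP. intros N.
    assert (s0 + eta / 2 <= s0); [|lra].
    apply Ub. split; [lra|]. intros s Hs.
    destruct (Rlt_le_dec s s0); [apply Qlt; lra|].
    destruct (Req_dec s s0) as [->|]; [exact Qs0|].
    apply NNPP. intros Ns. apply N. exists s. split; [lra|exact Ns]. }
  (* If no functional vanished at the exit point, all signs would persist and the ray could not
     leave there. *)
  assert (exists f, In f L /\ eval f (p t0 s0) = 0) as (f & Hf & Zf).
  { apply NNPP. intros N.
    destruct (common_radius L (fun f r => forall z, dist3 (p t0 s0) z < r ->
       0 <= eval f (p t0 s0) -> 0 <= eval f z)) as (r & Hr & A).
    - intros f r r' A B z Hz. apply A. lra.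
    - intros f Hf. destruct (Req_dec (eval f (p t0 s0)) 0) as [Z|NZ];
        [exfalso; apply N; eauto|].
      destruct (eval_sign_near f _ NZ) as (r & Hr & S).
      exists r. split; [exact Hr|]. intros z Hz Pz. specialize (S z Hz). nra.
    - destruct (small_scale e r Hr) as (d & Hd & Sm).
      destruct (Exit d Hd) as (s & Hs & Ns). apply Ns.
      apply (cells_same_signs P Cs (p t0 s0)); auto.
      intros g Hg. apply A; auto.
      rewrite Dp. apply Sm. rewrite Rabs_minus_sym, Rabs_pos_eq; lra. }
  assert (Nk : forall g, In g L -> eval g (p t0 s0) = 0 -> k g <> 0).
  { intros g Hg Z Zk. rewrite Ep, Zk in Z. apply (Nz g t0 Hg); lra. }
  assert (Kf := Nk f Hf Zf).
  assert (Ef : line_at (h f) t0 = s0).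
  { rewrite Epn in Zf by exact Kf. apply Rmult_integral in Zf. destruct Zf; [tauto|lra]. }
  assert (Ps0 : 0 < s0).
  { destruct (Req_dec s0 0) as [Z|]; [|lra]. exfalso.
    rewrite Ep, Z in Zf. apply (Nz f t0 Hf); lra. }
  (* Planes with equal heights at [t0] have equal heights for all [t], by steadiness, and then the
     same [nv], by genericity: every supporting plane through the exit point is the plane of [f]. *)
  assert (Coinc : forall g, In g L -> eval g (p t0 s0) = 0 ->
    forall z, eval g z = k g * (dot3 (nv f) z - dot3 (nv f) (p t0 s0))).
  { intros g Hg Zg. assert (Kg := Nk g Hg Zg).
    assert (Eg : line_at (h g) t0 = s0).
    { rewrite Epn in Zg by exact Kg. apply Rmult_integral in Zg. destruct Zg; [tauto|lra]. }
    assert (En : nv g = nv f).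
    { destruct (S2 (h g) (h f) (InG g Hg) (InG f Hf)) as [[_ A]|[[_ A]|A]].
      - specialize (A t0 ltac:(lra)). unfold line_at in *. simpl in *. lra.
      - specialize (A t0 ltac:(lra)). unfold line_at in *. simpl in *. lra.
      - apply NNPP. intros N. apply (Gen2 g f Hg Hf N).
        injection A as _ A. unfold h in A. simpl in A. rewrite <- A. vec. ring. }
    intros z.
    replace (eval g z) with (eval g z - eval g (p t0 s0)) by lra.
    rewrite <- En. unfold nv. rewrite !dot3_scale_l. unfold eval. field. exact Kg. }
  set (y := p t0 s0) in *.
  destruct (common_radius L (fun g r => eval g y <> 0 -> forall z, dist3 y z < r ->
       0 < eval g z * eval g y)) as (r & Hr & Near).
  { intros g r r' A B N z Hz. apply A; auto. lra. }
  { intros g Hg. destruct (Req_dec (eval g y) 0) as [Z|NZ].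
    - exists 1. split; [lra|]. tauto.
    - destruct (eval_sign_near g y NZ) as (r & Hr & S). eauto. }
  (* Near [y] the signs of all functionals are determined by the side of this one plane, so [P] is
     constant on either side. *)
  assert (Same : forall z z', dist3 y z < r -> dist3 y z' < r ->
    0 < (dot3 (nv f) z - dot3 (nv f) y) * (dot3 (nv f) z' - dot3 (nv f) y) -> P z -> P z').
  { intros z z' Dz Dz' Sd. apply (cells_same_signs P Cs); auto.
    intros g Hg Pz. destruct (Req_dec (eval g y) 0) as [Z|NZ].
    - rewrite (Coinc g Hg Z) in *. set (a := dot3 (nv f) z - dot3 (nv f) y) in *.
      set (b := dot3 (nv f) z' - dot3 (nv f) y) in *.
      apply Rmult_le_reg_r with (a * a); [apply Rsqr_pos_lt; intros Za; rewrite Za in Sd; lra|].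
      replace (k g * b * (a * a)) with (k g * a * (a * b)) by ring.
      rewrite Rmult_0_l. apply Rmult_le_pos; lra.
    - pose proof (Near g Hg NZ z Dz). pose proof (Near g Hg NZ z' Dz'). nra. }
  assert (Nvp : forall s, dot3 (nv f) (p t0 s) - dot3 (nv f) y = s0 - s).
  { intros s. unfold nv. rewrite !dot3_scale_l.
    replace (/ k f * dot3 (fst f) (p t0 s) - / k f * dot3 (fst f) y)
      with (/ k f * (eval f (p t0 s) - eval f y)) by (unfold eval; ring).
    unfold y. rewrite !Epn by exact Kf. field. exact Kf. }
  destruct (small_scale e r Hr) as (d & Hd & Sm).
  exists (nv f), y, r. split; [|split; [|split; [exact Qs0|]]].
  - unfold nv. rewrite dot3_scale_l. fold (k f). rewrite Rinv_l by exact Kf. lra.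
  - split; [exact Hr|]. intros z Hz. split; intros Side.
    + pose proof (Rmin_l d s0). pose proof (Rmin_r d s0).
      assert (0 < Rmin d s0) by (apply Rmin_glb_lt; lra).
      apply (Same (p t0 (s0 - Rmin d s0))); auto.
      * unfold y. rewrite Dp. apply Sm. rewrite Rabs_pos_eq; lra.
      * rewrite Nvp. nra.
      * apply Qlt. lra.
    + destruct (Exit d Hd) as (s & Hs & Ns). intros Pz. apply Ns.
      apply (Same z); auto.
      * unfold y. rewrite Dp. apply Sm. rewrite Rabs_minus_sym, Rabs_pos_eq; lra.
      * rewrite Nvp. nra.
  - intros z (tau & Htau & ->).
    destruct (Req_dec tau 0) as [->|Ntau].
    { replace (add3 x (scale3 0 (sub3 y x))) with x by (apply R3_ext; vec; ring). exact Hx. }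
    set (t := tau * t0). set (s := tau * s0).
    replace (add3 x (scale3 tau (sub3 y x))) with (p t s)
      by (unfold y, p, t, s; apply R3_ext; vec; ring).
    assert (Ht : 0 < t <= t0) by (unfold t; nra).
    assert (HsP : 0 < s) by (unfold s; nra).
    (* The segment runs inside the swept triangle. Its point at height [s] over [t] is compared with
       the point at the corresponding height [s'] over [t0], which lies on the stretch of the ray
       known to be in [P]. *)
    destruct (transfer_position (map (fun g => (line_at g t, line_at g t0)) GL) s) as (s' & Tr).
    { intros q q' Hq Hq'. apply in_map_iff in Hq, Hq'.
      destruct Hq as (g & <- & Hg), Hq' as (g' & <- & Hg'). simpl.
      assert (Dl : forall u, line_at (fst g - fst g', snd g - snd g') u = line_at g u - line_at g' u)
        by (intros; unfold line_at; simpl; ring).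
      destruct (S2 g g' Hg Hg') as [[_ A]|[[_ A]|A]].
      - pose proof (A t Ht). pose proof (A t0 ltac:(lra)). rewrite !Dl in *. lra.
      - pose proof (A t Ht). pose proof (A t0 ltac:(lra)). rewrite !Dl in *. lra.
      - pose proof (Dl t) as D1. pose proof (Dl t0) as D2. rewrite A in D1, D2.
        unfold line_at at 1 in D1. unfold line_at at 1 in D2. simpl in D1, D2. lra. }
    assert (Tr' : forall g, In g GL -> (line_at g t < s <-> line_at g t0 < s') /\
                                       (s < line_at g t <-> s' < line_at g t0)).
    { intros g Hg. apply (Tr (line_at g t, line_at g t0)). apply in_map_iff. eauto. }
    assert (Hs' : 0 < s').
    { destruct (Tr' (0, 0) (or_introl eq_refl)) as [A _]. unfold line_at in A. simpl in A.
      lra. }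
    (* The height of the plane of [f] is positive at [t0], so its value at [t = 0] is nonnegative;
       hence over [t] it is at least [tau * s0 = s], and the common order gives [s' <= s0]. *)
    assert (Hs'' : s' <= s0).
    { destruct (Tr' (h f) (InG f Hf)) as [A _]. rewrite Ef in A.
      apply Rnot_lt_le. intros Lt. apply A in Lt.
      destruct (S2 (h f) (0, 0) (InG f Hf) (or_introl eq_refl)) as [[B _]|[[_ B]|B]].
      - simpl in B. unfold line_at in *. unfold s, t in Lt. rewrite <- Ef in Lt. simpl in B, Lt.
        assert (0 <= (eval f x / k f) * (1 - tau)) by (apply Rmult_le_pos; lra). nra.
      - specialize (B t0 ltac:(lra)). unfold line_at in *. simpl in B, Ef. lra.
      - injection B as B1 B2. unfold line_at in Ef. simpl in Ef. nra. }
    assert (Qs' : Q s').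
    { destruct (Req_dec s' s0) as [->|]; [exact Qs0|]. apply Qlt. lra. }
    apply (cells_same_signs P Cs (p t0 s')); auto.
    (* Functionals constant along [e] see only [t] and have steady sign; for the others the sign is
       the position of the height relative to that of the plane. *)
    intros g Hg. destruct (Req_dec (k g) 0) as [Zk|Hk].
    + rewrite !Ep, Zk. intros Pg.
      destruct (S1 g Hg) as [[_ A]|[[_ A]|A]].
      * specialize (A t Ht). lra.
      * specialize (A t0 ltac:(lra)). lra.
      * rewrite A. unfold line_at. simpl. lra.
    + rewrite !Epn by exact Hk. destruct (Tr' (h g) (InG g Hg)) as [A B].
      set (a := line_at (h g) t) in *. set (b := line_at (h g) t0) in *.
      intros Pg.
      destruct (Rtotal_order (k g) 0) as [?|[?|?]]; [|tauto|];
      destruct (Rtotal_order a s) as [?|[?|?]]; intuition nra.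
Qed.

(** * Connectedness and faces *)

(** Take the supremum of the initial intervals on which [A] holds. *)
Lemma real_switch (A : R -> Prop) : A 0 -> ~ A 1 ->
  exists t0, 0 <= t0 <= 1 /\ forall d, 0 < d ->
    (exists t, 0 <= t <= 1 /\ Rabs (t - t0) < d /\ A t) /\
    (exists t, 0 <= t <= 1 /\ Rabs (t - t0) < d /\ ~ A t).
Proof.
  intros A0 A1.
  destruct (completeness (fun t => 0 <= t <= 1 /\ forall s, 0 <= s <= t -> A s)) as (t0 & Ub & Lub).
  { exists 1. intros t [? _]. lra. }
  { exists 0. split; [lra|]. intros s Hs. now replace s with 0 by lra. }
  assert (0 <= t0).
  { apply Ub. split; [lra|]. intros s Hs. now replace s with 0 by lra. }
  assert (t0 <= 1) by (apply Lub; intros t [? _]; lra).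
  assert (Near : forall d, 0 < d -> exists t, t0 - d < t /\ 0 <= t <= 1 /\ forall s, 0 <= s <= t -> A s).
  { intros d Hd. apply NNPP. intros N. assert (t0 <= t0 - d); [|lra].
    apply Lub. intros t [H1 H2]. apply Rnot_lt_le. intros L. apply N. eauto. }
  exists t0. split; [lra|]. intros d Hd. split.
  - destruct (Near d Hd) as (t & H1 & H2 & H3). exists t.
    assert (t <= t0) by (apply Ub; auto).
    split; [exact H2|]. split; [rewrite Rabs_left1; lra|]. apply H3. lra.
  - apply NNPP. intros N.
    assert (B : forall t, 0 <= t <= 1 -> Rabs (t - t0) < d -> A t).
    { intros t Ht Dt. apply NNPP. intros Nt. apply N. eauto. }
    destruct (Near d Hd) as (t1 & H1 & H2 & H3).
    assert (E : Rmin 1 (t0 + d / 2) <= t0).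
    { apply Ub. pose proof (Rmin_l 1 (t0 + d / 2)). pose proof (Rmin_r 1 (t0 + d / 2)).
      split; [split; [apply Rmin_glb; lra|lra]|].
      intros s Hs. destruct (Rle_lt_dec s t1); [apply H3; lra|].
      apply B; [lra|]. apply Rabs_def1; lra. }
    apply A1, B; [lra|]. revert E. unfold Rmin. destruct Rle_dec; intros; [|lra].
    apply Rabs_def1; lra.
Qed.

Lemma lerp_near p q t0 r : 0 < r -> exists d, 0 < d /\ forall t,
  Rabs (t - t0) < d -> dist3 (lerp p q t0) (lerp p q t) < r.
Proof.
  intros Hr. destruct (small_scale (sub3 q p) r Hr) as (d & Hd & S).
  exists d. split; [exact Hd|]. intros t Ht. rewrite dist3_lerp_lerp. apply S. lra.
Qed.

Lemma lerp_0 p q : lerp p q 0 = p.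
Proof. unfold lerp. apply R3_ext; vec; ring. Qed.

Lemma lerp_1 p q : lerp p q 1 = q.
Proof. unfold lerp. apply R3_ext; vec; ring. Qed.

Lemma segment_meets_boundary (S : R3 -> Prop) p q : S p -> ~ S q ->
  exists t, 0 <= t <= 1 /\ boundary S (lerp p q t).
Proof.
  intros Hp Hq.
  destruct (real_switch (fun t => S (lerp p q t))) as (t0 & Ht & A);
    rewrite ?lerp_0, ?lerp_1; auto.
  exists t0. split; [exact Ht|]. intros r Hr.
  destruct (lerp_near p q t0 r Hr) as (d & Hd & N).
  destruct (A d Hd) as [(t & _ & D & E) (t' & _ & D' & E')].
  split; [exists (lerp p q t)|exists (lerp p q t')]; auto.
Qed.

Lemma convex_connected (K : R3 -> Prop) :
  (forall p q t, K p -> K q -> 0 <= t <= 1 -> K (lerp p q t)) -> connected K.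
Proof.
  intros HK (U & V & OU & OV & Cov & (p & Kp & Up) & (q & Kq & Vq) & Dis).
  destruct (real_switch (fun t => U (lerp p q t))) as (t0 & Ht & A);
    rewrite ?lerp_0, ?lerp_1; eauto.
  destruct (Cov (lerp p q t0)) as [HU|HV]; auto.
  - destruct (OU _ HU) as (r & Hr & B).
    destruct (lerp_near p q t0 r Hr) as (d & Hd & N).
    destruct (A d Hd) as [_ (t & _ & D & E)]. auto.
  - destruct (OV _ HV) as (r & Hr & B).
    destruct (lerp_near p q t0 r Hr) as (d & Hd & N).
    destruct (A d Hd) as [(t & Ht' & D & E) _]. eauto.
Qed.

Lemma union_connected (Fam : (R3 -> Prop) -> Prop) y :
  (forall K, Fam K -> connected K /\ K y) ->
  connected (fun z => exists K, Fam K /\ K z).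
Proof.
  intros H (U & V & OU & OV & Cov & (p & (K & FK & Kp) & Up) & (q & (K' & FK' & Kq) & Vq) & Dis).
  destruct (H K FK) as [CK Ky], (H K' FK') as [CK' Ky'].
  destruct (Cov y) as [Uy|Vy]; [eauto| |].
  - apply CK'. exists U, V. repeat split; eauto.
  - apply CK. exists U, V. repeat split; eauto.
Qed.

Lemma connected_between_closure (C B : R3 -> Prop) : connected C ->
  (forall x, C x -> B x) -> (forall x, B x -> closure C x) -> connected B.
Proof.
  intros CC CB BC (U & V & OU & OV & Cov & (p & Bp & Up) & (q & Bq & Vq) & Dis).
  apply CC. exists U, V. repeat split; eauto.
  - destruct (OU p Up) as (r & Hr & A), (BC p Bp r Hr) as (z & Dz & Cz). eauto.
  - destruct (OV q Vq) as (r & Hr & A), (BC q Bq r Hr) as (z & Dz & Cz). eauto.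
Qed.

(** * Planes, relative interiors and closures *)

Definition plane (n : R3) (d : R) (x : R3) : Prop := dot3 n x = d.

Lemma plane_is_plane n d : n <> zero3 -> is_plane (plane n d).
Proof. intros H. exists n, d. split; [exact H|]. reflexivity. Qed.

(** A functional that is constant on a disc of the plane vanishes on all vectors orthogonal to [n],
    hence is a multiple of [n]. *)
Lemma normal_unique n n' d' y r : n <> zero3 -> 0 < r ->
  (forall z, plane n (dot3 n y) z -> dist3 y z < r -> dot3 n' z = d') ->
  exists k, n' = scale3 k n.
Proof.
  intros Hn Hr H. pose proof (dot3_self_pos n Hn) as Pn.
  set (k := dot3 n' n / dot3 n n). exists k.
  assert (E : forall v, dot3 n' v = k * dot3 n v).
  { intros v. set (v' := sub3 v (scale3 (dot3 n v / dot3 n n) n)).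
    assert (O : dot3 n v' = 0).
    { replace (dot3 n v') with (dot3 n v - dot3 n v / dot3 n n * dot3 n n)
        by (unfold v'; clear; generalize (dot3 n v / dot3 n n); intros; vec; ring).
      field. lra. }
    destruct (small_scale v' r Hr) as (d & Hd & S).
    assert (A := H (add3 y (scale3 d v'))). rewrite dist3_ray in A.
    specialize (A ltac:(unfold plane; replace (dot3 n (add3 y (scale3 d v')))
      with (dot3 n y + d * dot3 n v') by (clear; clearbody v'; vec; ring); rewrite O; ring)
      ltac:(apply S; rewrite Rabs_pos_eq; lra)).
    assert (B := H y eq_refl). rewrite dist3_refl in B. specialize (B Hr).
    replace (dot3 n' (add3 y (scale3 d v'))) with (dot3 n' y + d * dot3 n' v') in A
      by (clear; clearbody v'; vec; ring).
    assert (Z : d * dot3 n' v' = 0) by lra.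
    apply Rmult_integral in Z. destruct Z as [Z|Z]; [lra|].
    replace (dot3 n' v') with (dot3 n' v - dot3 n v / dot3 n n * dot3 n' n) in Z
      by (unfold v'; clear; generalize (dot3 n v / dot3 n n); intros; vec; ring).
    unfold k. apply Rminus_diag_uniq. rewrite <- Z. field. lra. }
  pose proof (E (mkR3 1 0 0)) as E1. pose proof (E (mkR3 0 1 0)) as E2.
  pose proof (E (mkR3 0 0 1)) as E3. clearbody k. clear - E1 E2 E3.
  destruct n, n'. vec. apply R3_ext; simpl; lra.
Qed.

(** Reconciles the planes that faces, open faces and floors each introduce by their own existential
    quantifier. *)
Lemma plane_unique H H' F y : is_plane H -> is_plane H' -> (forall x, F x -> H x) ->
  (forall x, F x -> H' x) -> relint H F y -> forall x, H x <-> H' x.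
Proof.
  intros (n & d & Hn & EH) (n' & d' & Hn' & EH') FH FH' (Fy & r & Hr & A).
  assert (Ed : dot3 n y = d) by (apply EH; auto).
  destruct (normal_unique n n' d' y r) as (k & ->); auto.
  { intros z Hz Dz. apply EH', FH', A; auto. apply EH. unfold plane in Hz. lra. }
  assert (Ed' : dot3 (scale3 k n) y = d') by (apply EH'; auto).
  assert (k <> 0).
  { intros ->. apply Hn'. apply R3_ext; vec; ring. }
  intros x. rewrite EH, EH', <- Ed, <- Ed', !dot3_scale_l. split; intros E; [now rewrite E|].
  apply Rmult_eq_reg_l with k; auto.
Qed.

Lemma relint_ext (H H' F : R3 -> Prop) x : (forall x, H x <-> H' x) -> relint H F x -> relint H' F x.
Proof.
  intros E (Fx & r & Hr & A). split; [exact Fx|]. exists r. split; [exact Hr|].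
  intros y Hy. apply A. now apply E.
Qed.

Lemma relint_disc H F x : relint H F x ->
  exists r, 0 < r /\ forall y, H y -> dist3 x y < r -> relint H F y.
Proof.
  intros (Fx & r & Hr & A). exists r. split; [exact Hr|]. intros y Hy Dy.
  split; [now apply A|]. exists (r - dist3 x y). split; [lra|]. intros z Hz Dz.
  apply A; auto. pose proof (dist3_triangle x y z). lra.
Qed.

Lemma relint_mono H (F G : R3 -> Prop) x : (forall x, F x -> G x) -> relint H F x -> relint H G x.
Proof. intros FG (Fx & r & Hr & A). split; eauto. Qed.

Lemma closure_idem S x : closure (closure S) x -> closure S x.
Proof.
  intros H r Hr. destruct (H (r / 2) ltac:(lra)) as (y & Dy & Hy).
  destruct (Hy (r / 2) ltac:(lra)) as (z & Dz & Hz).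
  exists z. split; [|exact Hz]. pose proof (dist3_triangle x y z). lra.
Qed.

Lemma closure_incl S (x : R3) : S x -> closure S x.
Proof. intros H r Hr. exists x. rewrite dist3_refl. auto. Qed.

Lemma closure_mono (S T : R3 -> Prop) x : (forall x, S x -> T x) -> closure S x -> closure T x.
Proof. intros ST H r Hr. destruct (H r Hr) as (y & Dy & Hy). eauto. Qed.

Lemma boundary_closed S x : closure (boundary S) x -> boundary S x.
Proof.
  intros H r Hr. destruct (H (r / 2) ltac:(lra)) as (y & Dy & Hy).
  destruct (Hy (r / 2) ltac:(lra)) as [(z & Dz & Sz) (z' & Dz' & Sz')].
  pose proof (dist3_triangle x y z). pose proof (dist3_triangle x y z').
  split; [exists z|exists z']; split; auto; lra.
Qed.

Lemma plane_closed H x : is_plane H -> closure H x -> H x.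
Proof.
  intros (n & d & Hn & EH) Cx. apply EH. apply NNPP. intros N.
  assert (Ne : eval (n, - d) x <> 0) by (unfold eval; simpl; lra).
  destruct (eval_sign_near _ x Ne) as (r & Hr & A).
  destruct (Cx r Hr) as (y & Dy & Hy). apply EH in Hy.
  specialize (A y Dy). unfold eval in A. simpl in A. rewrite Hy in A. lra.
Qed.

Lemma plane_lerp H p q t : is_plane H -> H p -> H q -> H (lerp p q t).
Proof.
  intros (n & d & Hn & EH) Hp Hq. apply EH in Hp, Hq. apply EH.
  assert (E := eval_lerp (n, 0) p q t). unfold eval in E. simpl in E. nra.
Qed.

(** * Connected components and the face through a point *)

Definition component (W : R3 -> Prop) (y z : R3) : Prop :=
  exists K, (connected K /\ (forall x, K x -> W x) /\ K y) /\ K z.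

Lemma component_connected W y : connected (component W y).
Proof. apply (union_connected _ y). tauto. Qed.

Lemma component_incl W y x : component W y x -> W x.
Proof. intros (K & (_ & KW & _) & Kx). auto. Qed.

(** A connected set through [z] stays connected when a planar disc around [z] is added. *)
Lemma component_open (H S : R3 -> Prop) y z : is_plane H -> (forall x, S x -> H x) ->
  component (relint H S) y z ->
  exists r, 0 < r /\ forall x, H x -> dist3 z x < r -> component (relint H S) y x.
Proof.
  intros PH SH (K & (CK & KW & Ky) & Kz).
  destruct (relint_disc H S z (KW z Kz)) as (r & Hr & A).
  assert (Hz : H z) by (apply SH, (KW z Kz)).
  exists r. split; [exact Hr|]. intros x Hx Dx.
  exists (fun u => exists K', (K' = K \/ K' = (fun u => H u /\ dist3 z u < r)) /\ K' u).
  split; [split; [|split]|].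
  - apply (union_connected _ z). intros K' [->| ->]; [tauto|].
    split; [|split; [exact Hz|rewrite dist3_refl; lra]].
    apply convex_connected. intros p q t [Hp Dp] [Hq Dq] Ht.
    split; [now apply plane_lerp|]. now apply dist3_lerp.
  - intros u (K' & [->| ->] & Ku); [auto|]. destruct Ku. auto.
  - exists K. auto.
  - eexists. split; [right; reflexivity|]. now split.
Qed.

(** The face is the closure of the component of [y] in the relative interior of the planar part of
    the boundary. It is maximal because a larger candidate has the same plane, so its relative
    interior is a connected subset of [W] through [y] and lies in that component. *)
Lemma face_through H P y : is_plane H ->
  relint H (fun x => H x /\ boundary P x) y ->
  exists F, is_face P F /\ (forall x, F x -> H x) /\ relint H F y.
Proof.
  intros PH Wy. set (S := fun x => H x /\ boundary P x) in *.
  set (W := relint H S) in *. set (C := component W y).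
  assert (SH : forall x, S x -> H x) by (intros x [? _]; auto).
  assert (Cy : C y).
  { exists (fun z => z = y). split; [split; [|split]|]; auto.
    - apply convex_connected. intros p q t -> -> _. unfold lerp. apply R3_ext; vec; ring.
    - intros x ->. exact Wy. }
  assert (CW : forall x, C x -> W x) by apply component_incl.
  assert (CS : forall x, C x -> S x) by (intros x Cx; apply (CW x Cx)).
  assert (FH : forall x, closure C x -> H x).
  { intros x Fx. apply plane_closed; auto. apply (closure_mono C); auto. }
  assert (CR : forall x, C x -> relint H (closure C) x).
  { intros x Cx. split; [now apply closure_incl|].
    destruct (component_open H S y x PH SH Cx) as (r & Hr & A).
    exists r. split; [exact Hr|]. intros z Hz Dz. apply closure_incl, A; auto. }
  exists (closure C). split; [split|split]; auto.
  - exists H. split; [exact PH|]. split; [exact FH|]. split; [|split; [|split; [|split]]].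
    + intros x Fx. apply boundary_closed. apply (closure_mono C); auto.
      intros z Cz. apply (CS z Cz).
    + exists y. auto.
    + apply (connected_between_closure C); auto; [apply component_connected|].
      intros x [Fx _]. exact Fx.
    + apply closure_mono. exact CR.
    + intros Fx. apply closure_idem. apply (closure_mono (relint H (closure C))); auto.
      intros z [Fz _]. exact Fz.
  - intros G (H' & PH' & GH' & GB & _ & GC & GR) FG x Gx.
    assert (EH := plane_unique H H' (closure C) y PH PH' FH ltac:(auto) (CR y Cy)).
    apply GR in Gx. apply (closure_mono (relint H' G)); [|exact Gx].
    intros z Rz. exists (relint H' G). split; [split; [exact GC|split]|exact Rz].
    + intros u Ru. apply relint_ext with H'; [intros; symmetry; apply EH|].
      apply (relint_mono H' G); [|exact Ru]. intros v Gv. split; [apply EH, GH'|]; auto.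
    + apply relint_ext with H; [exact EH|]. apply (relint_mono H (closure C)); auto.
Qed.

(** Small steps along [n] and [- n] from a nearby point of the plane lead into [P] and out of it. *)
Lemma one_sided_relint P n y r : n <> zero3 -> one_sided P n y r ->
  relint (plane n (dot3 n y)) (fun x => plane n (dot3 n y) x /\ boundary P x) y.
Proof.
  intros Hn (Hr & A). pose proof (dot3_self_pos n Hn) as Pn.
  assert (B : forall z, plane n (dot3 n y) z -> dist3 y z < r -> boundary P z).
  { intros z Hz Dz r' Hr'.
    destruct (small_scale n (Rmin r' (r - dist3 y z))) as (d & Hd & S).
    { apply Rmin_glb_lt; lra. }
    pose proof (Rmin_l r' (r - dist3 y z)). pose proof (Rmin_r r' (r - dist3 y z)).
    assert (E : forall t, dot3 n (add3 z (scale3 t n)) = dot3 n y + t * dot3 n n).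
    { intros t. rewrite <- Hz. vec; ring. }
    assert (Dt : forall t, Rabs t <= d -> dist3 z (add3 z (scale3 t n)) < r' /\
                                  dist3 y (add3 z (scale3 t n)) < r).
    { intros t Ht. specialize (S t Ht). rewrite <- (dist3_ray z) in S.
      pose proof (dist3_triangle y z (add3 z (scale3 t n))). lra. }
    destruct (Dt d) as [D1 D2]; [rewrite Rabs_pos_eq; lra|].
    destruct (Dt (- d)) as [D3 D4]; [rewrite Rabs_Ropp, Rabs_pos_eq; lra|].
    split; [exists (add3 z (scale3 d n))|exists (add3 z (scale3 (- d) n))];
      (split; [assumption|]); apply A; auto; rewrite E; nra. }
  split.
  - split; [reflexivity|]. apply B; [reflexivity|]. now rewrite dist3_refl.
  - exists r. split; [exact Hr|]. split; auto.
Qed.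

(** * Faces have a well-defined side *)

Lemma plane_basis n : n <> zero3 -> exists f1 f2,
  f1 <> zero3 /\ f2 <> zero3 /\ dot3 n f1 = 0 /\ dot3 n f2 = 0 /\ dot3 f1 f2 = 0.
Proof.
  intros Hn.
  assert (exists f1, f1 <> zero3 /\ dot3 n f1 = 0) as (f1 & N1 & O1).
  { destruct n as [a b c]. destruct (Req_dec a 0) as [->|Na].
    - exists (mkR3 1 0 0). split; [|vec; ring]. intros E. injection E. lra.
    - exists (mkR3 (- b) a 0). split; [|vec; ring]. intros E. injection E. lra. }
  exists f1, (cross3 n f1). repeat split; auto.
  - intros E. pose proof (dot3_self_pos n Hn). pose proof (dot3_self_pos f1 N1).
    assert (L : dot3 (cross3 n f1) (cross3 n f1) =
                dot3 n n * dot3 f1 f1 - dot3 n f1 * dot3 n f1)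
      by (unfold cross3; vec; ring).
    rewrite E, O1 in L. replace (dot3 zero3 zero3) with 0 in L by (vec; ring). nra.
  - unfold cross3; vec; ring.
  - unfold cross3; vec; ring.
Qed.

(** The chart [phi], restricted to a planar disc in [F] around [y], is a continuous injection of a
    disc into the plane, so its image contains a neighbourhood of [phi y]. A point of [S] near [y]
    shares its chart value with a point of the disc and therefore equals it. *)
Lemma manifold_planar S H F y : two_manifold S -> is_plane H ->
  (forall x, F x -> S x) -> (forall x, F x -> H x) -> relint H F y ->
  exists r, 0 < r /\ forall z, S z -> dist3 y z < r -> H z.
Proof.
  intros M (n & d & Hn & EH) FS FH (Fy & r & Hr & A).
  destruct (M y (FS y Fy)) as (U & OU & Uy & phi & psi & _ & _ & Inv & _ & Cphi & _).
  destruct (OU y Uy) as (r' & Hr' & BU).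
  destruct (plane_basis n Hn) as (f1 & f2 & N1 & N2 & O1 & O2 & O12).
  set (K := norm3 f1 + norm3 f2 + 1).
  pose proof (norm3_nonneg f1). pose proof (norm3_nonneg f2).
  assert (Pm : 0 < Rmin r r') by (apply Rmin_glb_lt; lra).
  pose proof (Rmin_l r r'). pose proof (Rmin_r r r').
  (* Makes the parametrised disc [q] stay in the relative interior and in the chart domain, without
     normalising [f1] and [f2]. *)
  set (rho := Rmin r r' / K).
  assert (Prho : 0 < rho) by (apply Rdiv_lt_0_compat; unfold K; lra).
  assert (ErhoK : rho * K = Rmin r r') by (unfold rho; field; unfold K; lra).
  pose (q (u : R2) := add3 y (add3 (scale3 (rho * fst u) f1) (scale3 (rho * snd u) f2))).
  assert (Bound : forall a b m, 0 <= m -> Rabs a <= m -> Rabs b <= m ->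
    norm3 (add3 (scale3 (rho * a) f1) (scale3 (rho * b) f2)) <= m * (rho * (K - 1))).
  { intros a b m Hm Ha Hb. eapply Rle_trans; [apply norm3_triangle|].
    rewrite !norm3_scale, !Rabs_mult, (Rabs_pos_eq rho) by lra.
    assert (rho * Rabs a * norm3 f1 <= rho * m * norm3 f1)
      by (apply Rmult_le_compat_r; [lra|apply Rmult_le_compat_l; lra]).
    assert (rho * Rabs b * norm3 f2 <= rho * m * norm3 f2)
      by (apply Rmult_le_compat_r; [lra|apply Rmult_le_compat_l; lra]).
    unfold K. lra. }
  assert (Near : forall u, closed_disc u -> dist3 y (q u) < Rmin r r').
  { intros u Du. unfold q. rewrite dist3_add.
    assert (Rabs (fst u) <= 1 /\ Rabs (snd u) <= 1) as [B1 B2].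
    { unfold closed_disc in Du. pose proof (pow2_ge_0 (fst u)). pose proof (pow2_ge_0 (snd u)).
      split; apply Rabs_le; split; nra. }
    pose proof (Bound _ _ 1 ltac:(lra) B1 B2). nra. }
  assert (Fq : forall u, closed_disc u -> F (q u)).
  { intros u Du. pose proof (Near u Du). apply A; [|lra].
    apply EH. rewrite <- (proj1 (EH y) (FH y Fy)). unfold q.
    replace (dot3 n _) with (dot3 n y + rho * fst u * dot3 n f1 + rho * snd u * dot3 n f2)
      by (clear; vec; ring).
    rewrite O1, O2. ring. }
  assert (Uq : forall u, closed_disc u -> U (q u)).
  { intros u Du. pose proof (Near u Du). apply BU. lra. }
  destruct (invariance_of_domain (fun u => phi (q u))) as (dl & Hdl & Inside).
  - intros u Du eps He.
    destruct (Cphi (q u) ltac:(split; auto) eps He) as (del & Hdel & C).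
    exists (del / (rho * K)). split; [apply Rdiv_lt_0_compat; lra|].
    intros v Dv Duv. apply C; [split; auto|].
    destruct (dist2_coord u v) as [B1 B2].
    assert (P0 : 0 <= dist2 u v) by apply sqrt_pos.
    assert (E : dist3 (q u) (q v) = norm3 (add3 (scale3 (rho * (fst u - fst v)) f1)
                                            (scale3 (rho * (snd u - snd v)) f2))).
    { unfold dist3. f_equal. unfold q. apply R3_ext; vec; ring. }
    rewrite E. pose proof (Bound _ _ _ P0 B1 B2).
    assert (dist2 u v * (rho * K) < del).
    { apply Rmult_lt_compat_r with (r := rho * K) in Duv; [|lra].
      unfold Rdiv in Duv. rewrite Rmult_assoc, Rinv_l in Duv; lra. }
    nra.
  - intros u v Du Dv E.
    assert (Eq : q u = q v).
    { rewrite <- (Inv (q u)), <- (Inv (q v)); auto. now f_equal. }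
    assert (E1 : dot3 f1 (sub3 (q u) (q v)) = rho * (fst u - fst v) * dot3 f1 f1 +
                 rho * (snd u - snd v) * dot3 f1 f2) by (unfold q; clear; vec; ring).
    assert (E2 : dot3 f2 (sub3 (q u) (q v)) = rho * (fst u - fst v) * dot3 f1 f2 +
                 rho * (snd u - snd v) * dot3 f2 f2) by (unfold q; clear; vec; ring).
    rewrite Eq, O12 in E1, E2.
    assert (Z : forall f, dot3 f (sub3 (q v) (q v)) = 0) by (intros; clear; vec; ring).
    rewrite Z in E1, E2.
    pose proof (dot3_self_pos f1 N1). pose proof (dot3_self_pos f2 N2).
    assert (Z1 : (rho * dot3 f1 f1) * (fst u - fst v) = 0) by lra.
    assert (Z2 : (rho * dot3 f2 f2) * (snd u - snd v) = 0) by lra.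
    apply Rmult_integral in Z1, Z2.
    assert (0 < rho * dot3 f1 f1) by (apply Rmult_lt_0_compat; lra).
    assert (0 < rho * dot3 f2 f2) by (apply Rmult_lt_0_compat; lra).
    destruct u, v; simpl in *. f_equal; lra.
  - assert (Ey : q (0, 0) = y) by (unfold q; apply R3_ext; vec; ring).
    destruct (Cphi y ltac:(split; auto) dl Hdl) as (del & Hdel & C).
    exists (Rmin del r'). pose proof (Rmin_l del r'). pose proof (Rmin_r del r').
    split; [apply Rmin_glb_lt; lra|]. intros z Sz Dz.
    assert (Uz : U z) by (apply BU; lra).
    destruct (Inside (phi z)) as (u & Du & Eu).
    { rewrite Ey. apply C; [split; auto|lra]. }
    assert (z = q u) as ->.
    { rewrite <- (Inv z), <- (Inv (q u)); auto. now f_equal. }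
    auto.
Qed.

(** With the boundary planar near [y], a segment on one side of the plane cannot cross it, so each
    half ball is inside or outside [P]. Both inside would make the whole ball part of the closed set
    [P]; both outside contradicts the cell at [y], which has interior points off the plane
    arbitrarily near [y]. *)
Lemma polyhedron_side P Cs n F y : cells_of P Cs -> two_manifold (boundary P) ->
  n <> zero3 -> (forall x, F x -> boundary P x) ->
  (forall x, F x -> plane n (dot3 n y) x) -> relint (plane n (dot3 n y)) F y ->
  exists r, one_sided P n y r \/ one_sided P (scale3 (-1) n) y r.
Proof.
  intros HPC M Hn FB FH Ry. pose proof (dot3_self_pos n Hn) as Pn.
  destruct (manifold_planar _ _ F y M (plane_is_plane n (dot3 n y) Hn) FB FH Ry) as (r & Hr & A).
  assert (Const : forall p q, dist3 y p < r -> dist3 y q < r ->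
    0 < (dot3 n p - dot3 n y) * (dot3 n q - dot3 n y) -> P p -> P q).
  { intros p q Dp Dq Side Pp. apply NNPP. intros Nq.
    destruct (segment_meets_boundary P p q Pp Nq) as (t & Ht & B).
    assert (Z := A _ B (dist3_lerp y p q t r Ht Dp Dq)). unfold plane in Z.
    assert (E := eval_lerp (n, - dot3 n y) p q t). unfold eval in E. simpl in E.
    rewrite Z in E.
    set (a := dot3 n p - dot3 n y) in *. set (b := dot3 n q - dot3 n y) in *.
    replace (dot3 n p + - dot3 n y) with a in E by (unfold a; ring).
    replace (dot3 n q + - dot3 n y) with b in E by (unfold b; ring).
    destruct (Rtotal_order a 0) as [?|[Za|?]].
    - assert (b < 0) by nra. destruct (Req_dec t 0) as [->|]; [lra|]. nra.
    - rewrite Za in Side. lra.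
    - assert (0 < b) by nra. destruct (Req_dec t 0) as [->|]; [lra|]. nra. }
  destruct (small_scale n r Hr) as (d & Hd & S).
  set (up := add3 y (scale3 d n)). set (dn := add3 y (scale3 (- d) n)).
  assert (Dup : dist3 y up < r) by (unfold up; rewrite dist3_ray; apply S; rewrite Rabs_pos_eq; lra).
  assert (Ddn : dist3 y dn < r)
    by (unfold dn; rewrite dist3_ray; apply S; rewrite Rabs_Ropp, Rabs_pos_eq; lra).
  assert (Eup : dot3 n up - dot3 n y = d * dot3 n n) by (unfold up; vec; ring).
  assert (Edn : dot3 n dn - dot3 n y = - d * dot3 n n) by (unfold dn; vec; ring).
  assert (Pd : 0 < d * dot3 n n) by (apply Rmult_lt_0_compat; lra).
  assert (Closed : forall x, (forall r, 0 < r -> exists z, dist3 x z < r /\ P z) -> P x).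
  { intros x H. apply NNPP. intros N. destruct (cells_closed P Cs x HPC N) as (r1 & Hr1 & B).
    destruct (H r1 Hr1) as (z & Dz & Pz). exact (B z Dz Pz). }
  assert (By : boundary P y) by (apply FB, Ry).
  exists r. unfold one_sided. setoid_rewrite dot3_scale_l.
  destruct (classic (P up)) as [Pu|Nu], (classic (P dn)) as [Pdn|Ndn].
  - exfalso.
    assert (Off : forall z, dist3 y z < r -> dot3 n z <> dot3 n y -> P z).
    { intros z Dz Nz. destruct (Rtotal_order (dot3 n z) (dot3 n y)) as [?|[?|?]]; [|tauto|].
      - apply (Const dn); auto. rewrite Edn. nra.
      - apply (Const up); auto. rewrite Eup. nra. }
    destruct (By r Hr) as [_ (z & Dz & Nz)]. apply Nz.
    destruct (Req_dec (dot3 n z) (dot3 n y)) as [Ez|Ez]; [|now apply Off].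
    apply Closed. intros r1 Hr1.
    assert (Pm : 0 < Rmin r1 (r - dist3 y z)) by (apply Rmin_glb_lt; lra).
    pose proof (Rmin_l r1 (r - dist3 y z)). pose proof (Rmin_r r1 (r - dist3 y z)).
    destruct (small_scale n _ Pm) as (d1 & Hd1 & S1).
    specialize (S1 d1 ltac:(rewrite Rabs_pos_eq; lra)). rewrite <- (dist3_ray z) in S1.
    exists (add3 z (scale3 d1 n)). split; [lra|]. apply Off.
    + pose proof (dist3_triangle y z (add3 z (scale3 d1 n))). lra.
    + replace (dot3 n (add3 z (scale3 d1 n))) with (dot3 n z + d1 * dot3 n n) by (clear; vec; ring).
      nra.
  - left. split; [exact Hr|]. intros z Dz. split; intros Side.
    + apply (Const up); auto. rewrite Eup. nra.
    + intros Pz. apply Ndn. apply (Const z); auto. rewrite Edn. nra.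
  - right. split; [exact Hr|]. intros z Dz. split; intros Side.
    + apply (Const dn); auto. rewrite Edn. nra.
    + intros Pz. apply Nu. apply (Const z); auto. rewrite Eup. nra.
  - exfalso.
    assert (Off : forall z, dist3 y z < r -> dot3 n z <> dot3 n y -> ~ P z).
    { intros z Dz Nz Pz. destruct (Rtotal_order (dot3 n z) (dot3 n y)) as [?|[?|?]]; [|tauto|].
      - apply Ndn. apply (Const z); auto. rewrite Edn. nra.
      - apply Nu. apply (Const z); auto. rewrite Eup. nra. }
    assert (Py : P y).
    { apply Closed. intros r1 Hr1. exact (proj1 (By r1 Hr1)). }
    destruct HPC as (I1 & I2 & I3 & _).
    destruct (proj1 (I1 y) Py) as (C & HC & HyC).
    destruct (I3 C HC) as (c & Hc).
    destruct (common_radius C (fun f r => forall z, dist3 c z < r -> 0 < eval f z))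
      as (r1 & Hr1 & Int).
    { intros f r1 r2 B HB z Hz. apply B. lra. }
    { intros f Hf. pose proof (Hc f Hf). destruct (eval_sign_near f c ltac:(lra)) as (r1 & Hr1 & S1).
      exists r1. split; [exact Hr1|]. intros z Hz. specialize (S1 z Hz). nra. }
    (* A direction from [y] into the interior of the cell, chosen not parallel to the plane. *)
    destruct (generic_vector [n] (sub3 c y) r1 Hr1) as (w & Dw & Gw).
    specialize (Gw n (or_introl eq_refl) Hn).
    assert (Ic : forall f, In f C -> 0 < eval f (add3 y w)).
    { intros f Hf. apply (Int f Hf). unfold dist3 in *.
      replace (sub3 c (add3 y w)) with (sub3 (sub3 c y) w) by (apply R3_ext; vec; ring).
      exact Dw. }
    destruct (small_scale w r Hr) as (d1 & Hd1 & S1).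
    set (t := Rmin d1 1). pose proof (Rmin_l d1 1). pose proof (Rmin_r d1 1).
    assert (0 < t) by (apply Rmin_glb_lt; lra). fold t in H, H0.
    apply (Off (add3 y (scale3 t w))).
    + rewrite dist3_ray. apply S1. rewrite Rabs_pos_eq; lra.
    + replace (dot3 n (add3 y (scale3 t w))) with (dot3 n y + t * dot3 n w) by (clear; vec; ring).
      intros E. assert (Z : t * dot3 n w = 0) by lra.
      apply Rmult_integral in Z. destruct Z; [lra|tauto].
    + apply I1. exists C. split; [exact HC|]. intros f Hf.
      replace (add3 y (scale3 t w)) with (lerp y (add3 y w) t)
        by (unfold lerp; apply R3_ext; vec; ring).
      rewrite eval_lerp. pose proof (HyC f Hf). pose proof (Ic f Hf). nra.
Qed.

(** Witnessed at a single point [y], as the ray argument delivers it; that no other point of a face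
    witnesses the opposite side is [floor_not_ceiling]. *)
Definition floor (P : R3 -> Prop) (e : R3) (F : R3 -> Prop) : Prop :=
  exists n y r, 0 < dot3 n e /\ one_sided P n y r /\
    (forall x, F x -> plane n (dot3 n y) x) /\ relint (plane n (dot3 n y)) F y.

Lemma pos_dot_nonzero n e : 0 < dot3 n e -> n <> zero3.
Proof. intros H ->. replace (dot3 zero3 e) with 0 in H by (vec; ring). lra. Qed.

Lemma connected_ext (A B : R3 -> Prop) : (forall x, A x <-> B x) -> connected A -> connected B.
Proof.
  intros E C. apply (connected_between_closure A); auto; intros x Hx.
  - now apply E.
  - apply closure_incl. now apply E.
Qed.

(** By [polyhedron_side] the relative interior splits into the points with [P] on the side of [n]
    and those with [P] on the side of [- n]. Both sets are relatively open and they are disjoint, so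
    two witnesses on opposite sides would disconnect it. *)
Lemma floor_not_ceiling P Cs e F : cells_of P Cs -> two_manifold (boundary P) ->
  is_face P F -> floor P e F -> floor P (scale3 (-1) e) F -> False.
Proof.
  intros HPC M [(H & PH & FH & FB & _ & Conn & _) _]
    (n & y & r & Pe & Os & Fp & Ry) (n' & y' & r' & Pe' & Os' & Fp' & Ry').
  assert (Nn := pos_dot_nonzero _ _ Pe). assert (Nn' := pos_dot_nonzero _ _ Pe').
  set (d := dot3 n y) in *.
  assert (EH := plane_unique _ _ F y (plane_is_plane n d Nn) PH Fp FH Ry).
  assert (EH' := plane_unique _ _ F y' (plane_is_plane n' _ Nn') (plane_is_plane n d Nn) Fp' Fp Ry').
  assert (C : connected (relint (plane n d) F)).
  { apply (connected_ext (relint H F)); auto. intros x. split; apply relint_ext; intros.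
    - symmetry. apply EH. - apply EH. }
  assert (Ry2 : relint (plane n d) F y') by (apply relint_ext with (plane n' (dot3 n' y')); auto).
  assert (Dy' : dot3 n y' = d) by (apply Fp, Ry').
  (* Both normals belong to one plane, so [n' = k n], and their products with [e] have opposite
     signs, so [k < 0]. *)
  assert (Os2 : one_sided P (scale3 (-1) n) y' r').
  { destruct (normal_unique n n' (dot3 n' y') y' 1 Nn ltac:(lra)) as (k & ->).
    { intros z Hz _. apply EH'. unfold plane in *. lra. }
    rewrite dot3_scale_r, dot3_scale_l in Pe'.
    destruct Os' as (Hr' & A). split; [exact Hr'|]. intros z Dz. specialize (A z Dz).
    rewrite !dot3_scale_l in *.
    split; intros Side; apply A; nra. }
  pose (side m z := exists u s, relint (plane n d) F u /\ one_sided P m u s /\ dist3 u z < s).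
  assert (Open : forall m, open3 (side m)).
  { intros m z (u & s & Ru & Ou & Du). exists (s - dist3 u z). split; [lra|].
    intros x Dx. exists u, s. split; [exact Ru|]. split; [exact Ou|].
    pose proof (dist3_triangle u z x). lra. }
  apply C. exists (side n), (side (scale3 (-1) n)).
  split; [apply Open|]. split; [apply Open|]. split; [|split; [|split]].
  - intros x Rx. assert (Ex : dot3 n x = d) by (apply Fp, Rx).
    destruct (polyhedron_side P Cs n F x HPC M Nn FB) as (s & [Hs|Hs]); rewrite ?Ex; auto;
      [left|right]; exists x, s; rewrite dist3_refl; (split; [exact Rx|]);
      (split; [exact Hs|apply Hs]).
  - exists y. split; [exact Ry|]. exists y, r. rewrite dist3_refl. split; [exact Ry|].
    split; [exact Os|apply Os].
  - exists y'. split; [exact Ry2|]. exists y', r'. rewrite dist3_refl. split; [exact Ry2|].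
    split; [exact Os2|apply Os2].
  - intros x Rx (u & s & Ru & (_ & A) & Du) (u' & s' & Ru' & (_ & A') & Du').
    pose proof (dot3_self_pos n Nn) as Pn.
    assert (dot3 n x = d) by (apply Fp, Rx). assert (dot3 n u = d) by (apply Fp, Ru).
    assert (dot3 n u' = d) by (apply Fp, Ru').
    destruct (small_scale n (Rmin (s - dist3 u x) (s' - dist3 u' x))) as (t & Ht & S).
    { apply Rmin_glb_lt; lra. }
    pose proof (Rmin_l (s - dist3 u x) (s' - dist3 u' x)).
    pose proof (Rmin_r (s - dist3 u x) (s' - dist3 u' x)).
    specialize (S t ltac:(rewrite Rabs_pos_eq; lra)). rewrite <- (dist3_ray x) in S.
    set (z := add3 x (scale3 t n)) in *.
    pose proof (dist3_triangle u x z). pose proof (dist3_triangle u' x z).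
    assert (Ez : dot3 n z = d + t * dot3 n n)
      by (unfold z; replace d with (dot3 n x) by assumption; clear; vec; ring).
    apply (A' z); [lra| |].
    + rewrite !dot3_scale_l. nra.
    + apply (A z); [lra|nra].
Qed.

(** A unit vector orthogonal to the face is a nonzero multiple of [n]. *)
Lemma floor_not_vertical P e F v : floor P e F -> norm3 v = 1 ->
  (forall p q, F p -> F q -> dot3 (sub3 p q) v = 0) -> dot3 v e <> 0.
Proof.
  intros (n & y & r & Pe & Os & Fp & (Fy & s & Hs & A)) Nv Hv Z.
  assert (Nn := pos_dot_nonzero _ _ Pe).
  destruct (normal_unique n v (dot3 v y) y s Nn Hs) as (k & ->).
  { intros z Hz Dz. specialize (Hv z y (A z Hz Dz) Fy).
    replace (dot3 (sub3 z y) v) with (dot3 v z - dot3 v y) in Hv by (clear; vec; ring). lra. }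
  rewrite dot3_scale_l in Z. apply Rmult_integral in Z. destruct Z as [->|Z]; [|lra].
  unfold norm3 in Nv. rewrite dot3_scale_l, Rmult_0_l, sqrt_0 in Nv. lra.
Qed.

Lemma floor_point_seen P Cs e x : cells_of P Cs -> e <> zero3 -> P x ->
  exists F y, is_face P F /\ floor P e F /\ open_face F y /\ visible P y x.
Proof.
  intros HPC He Hx.
  destruct (sees_below P Cs e x HPC He Hx) as (n & y & r & Pe & Os & Py & Seg).
  assert (Nn := pos_dot_nonzero _ _ Pe).
  destruct (face_through (plane n (dot3 n y)) P y (plane_is_plane _ _ Nn)
    (one_sided_relint P n y r Nn Os)) as (F & HF & FH & Ry).
  exists F, y. split; [exact HF|]. split; [exists n, y, r; auto|]. split.
  - exists (plane n (dot3 n y)). auto using plane_is_plane.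
  - intros z (t & Ht & ->) (s & Hs & B). apply (B (add3 y (scale3 t (sub3 x y)))).
    + now rewrite dist3_refl.
    + apply Seg. exists (1 - t). split; [lra|]. apply R3_ext; vec; ring.
Qed.

(** * Counting faces *)

(** Properties such as being a floor come without a decision procedure, hence the filter through
    informative excluded middle. *)
Definition select {A} (Q : A -> Prop) (l : list A) : list A :=
  filter (fun a => if excluded_middle_informative (Q a) then true else false) l.

Lemma in_select {A} (Q : A -> Prop) l a : In a (select Q l) <-> In a l /\ Q a.
Proof.
  unfold select. rewrite filter_In. destruct excluded_middle_informative; intuition discriminate.
Qed.

Lemma length_select_cons {A} (Q : A -> Prop) a l :
  (Q a /\ length (select Q (a :: l)) = S (length (select Q l))) \/
  (~ Q a /\ length (select Q (a :: l)) = length (select Q l)).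
Proof. unfold select. simpl. destruct excluded_middle_informative; auto. Qed.

Lemma length_select_split {A} (Q : A -> Prop) l :
  (length (select Q l) + length (select (fun a => ~ Q a) l) = length l)%nat.
Proof.
  induction l as [|a l IH]; [reflexivity|].
  destruct (length_select_cons Q a l) as [[? ->]|[? ->]],
    (length_select_cons (fun a => ~ Q a) a l) as [[? ->]|[? ->]]; simpl; try tauto; lia.
Qed.

Lemma length_select_select {A} (Q Q' : A -> Prop) l :
  (length (select Q' (select Q l)) <= length (select Q' l))%nat.
Proof.
  induction l as [|a l IH]; [auto|].
  change (select Q (a :: l)) with
    (if if excluded_middle_informative (Q a) then true else false
     then a :: select Q l else select Q l).
  pose proof (length_select_cons Q' a l). pose proof (length_select_cons Q' a (select Q l)).
  destruct excluded_middle_informative; intuition lia.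
Qed.

Lemma length_select_disjoint {A} (Q Q' R' : A -> Prop) l :
  (forall a, In a l -> Q a -> Q' a -> False) ->
  (forall a, In a l -> Q a \/ Q' a -> R' a) ->
  (length (select Q l) + length (select Q' l) <= length (select R' l))%nat.
Proof.
  induction l as [|a l IH]; intros H1 H2; [auto|].
  specialize (IH ltac:(intros; eapply H1; simpl; eauto) ltac:(intros; apply H2; simpl; auto)).
  pose proof (H1 a (or_introl eq_refl)). pose proof (H2 a (or_introl eq_refl)).
  destruct (length_select_cons Q a l) as [[? ->]|[? ->]],
    (length_select_cons Q' a l) as [[? ->]|[? ->]],
    (length_select_cons R' a l) as [[? ->]|[? ->]]; try tauto; lia.
Qed.

Lemma covered_length {A B} (rel : A -> B -> Prop) k vs : forall fs : list A,
  (forall f, In f fs -> exists v, In v vs /\ rel f v) ->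
  (forall v, In v vs -> (length (select (fun f => rel f v) fs) <= k)%nat) ->
  (length fs <= k * length vs)%nat.
Proof.
  induction vs as [|v vs IH]; intros fs Cov Small.
  - destruct fs as [|f fs]; [simpl; lia|]. destruct (Cov f (or_introl eq_refl)) as (v & [] & _).
  - specialize (IH (select (fun f => ~ rel f v) fs)).
    assert ((length (select (fun f => ~ rel f v) fs) <= k * length vs)%nat).
    { apply IH.
      - intros f Hf. apply in_select in Hf. destruct Hf as [Hf Nf].
        destruct (Cov f Hf) as (v' & [<-|Hv] & Rv); [tauto|eauto].
      - intros v' Hv'. eapply Nat.le_trans; [apply length_select_select|].
        apply Small. now right. }
    pose proof (length_select_split (fun f => rel f v) fs).
    specialize (Small v (or_introl eq_refl)). simpl. lia.
Qed.

(** Pigeonhole with the largest class. The list is returned split at [v], so that removing this one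
    occurrence shortens it by exactly one even if vectors are repeated. *)
Lemma popular {A B} (rel : A -> B -> Prop) vs (fs : list A) : vs <> [] ->
  (forall f, In f fs -> exists v, In v vs /\ rel f v) ->
  exists l1 v l2, vs = l1 ++ v :: l2 /\
    (length fs <= length (select (fun f => rel f v) fs) * length vs)%nat.
Proof.
  intros Ne Cov.
  assert (exists v, In v vs /\ forall v', In v' vs ->
    (length (select (fun f => rel f v') fs) <= length (select (fun f => rel f v) fs))%nat)
    as (v & Hv & Max).
  { clear Cov. induction vs as [|v vs IH]; [tauto|].
    destruct vs as [|v2 vs].
    - exists v. split; [now left|]. intros v' [<-|[]]. lia.
    - destruct IH as (m & Hm & Max); [discriminate|].
      destruct (Nat.le_ge_cases (length (select (fun f => rel f v) fs))
                  (length (select (fun f => rel f m) fs))) as [L|L].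
      + exists m. split; [now right|]. intros v' [<-|Hv']; auto.
      + exists v. split; [now left|]. intros v' [<-|Hv']; [lia|].
        specialize (Max v' Hv'). lia. }
  destruct (in_split v vs Hv) as (l1 & l2 & E). exists l1, v, l2. split; [exact E|].
  apply (covered_length rel _ vs fs Cov Max).
Qed.

(** Pigeonhole twice: at most [f (c - 1) / c] elements survive the first vector, and of these at
    most the fraction [(c - 2) / (c - 1)] survives the second, chosen among the other [c - 1]. The
    product is [f (1 - 2 / c)]. *)
Lemma two_popular {A B} (rel : A -> B -> Prop) c vs (fs : list A) :
  length vs = c -> (2 <= c)%nat ->
  (forall f, In f fs -> exists v, In v vs /\ rel f v) ->
  exists v v', In v vs /\ In v' vs /\
    INR (length (select (fun f => ~ rel f v /\ ~ rel f v') fs))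
      <= INR (length fs) * (1 - 2 / INR c).
Proof.
  intros Lc Hc Cov.
  destruct (popular rel vs fs) as (l1 & v & l2 & E & M1); auto.
  { intros ->. simpl in Lc. lia. }
  set (fs' := select (fun f => ~ rel f v) fs).
  assert (Lv : length (l1 ++ l2) = (c - 1)%nat).
  { rewrite <- Lc, E, !length_app. simpl. lia. }
  destruct (popular rel (l1 ++ l2) fs') as (m1 & v' & m2 & E' & M2).
  { intros Z. rewrite Z in Lv. simpl in Lv. lia. }
  { intros f Hf. apply in_select in Hf. destruct Hf as [Hf Nf].
    destruct (Cov f Hf) as (u & Hu & Ru). exists u. split; [|exact Ru].
    rewrite E in Hu. apply in_app_or in Hu. apply in_or_app.
    destruct Hu as [?|[<-|?]]; auto. tauto. }
  assert (Hv' : In v' (l1 ++ l2)) by (rewrite E'; apply in_or_app; right; now left).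
  exists v, v'. split; [rewrite E; apply in_or_app; right; now left|].
  split. { rewrite E. apply in_or_app. apply in_app_or in Hv'. simpl. tauto. }
  rewrite Lv in M2. rewrite Lc in M1.
  assert (S1 : (length (select (fun f => rel f v) fs) + length fs' = length fs)%nat)
    by apply length_select_split.
  assert (S2 : (length (select (fun f => rel f v') fs')
                + length (select (fun f => ~ rel f v') fs') = length fs')%nat)
    by apply length_select_split.
  assert (S3 : length (select (fun f => ~ rel f v /\ ~ rel f v') fs) =
               length (select (fun f => ~ rel f v') fs')).
  { unfold fs', select. clear. induction fs as [|f fs IH]; [reflexivity|]. simpl.
    do 2 destruct excluded_middle_informative; simpl; try tauto;
      try destruct excluded_middle_informative; simpl; try tauto; lia. }
  rewrite S3. set (n1 := length (select (fun f => rel f v) fs)) in *.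
  set (n2 := length (select (fun f => rel f v') fs')) in *.
  set (m := length (select (fun f => ~ rel f v') fs')) in *.
  assert (Hc1 : (1 <= c)%nat) by lia.
  apply le_INR in M1, M2, Hc. rewrite mult_INR in M1, M2. rewrite minus_INR in M2 by exact Hc1.
  apply (f_equal INR) in S1, S2. rewrite plus_INR in S1, S2. simpl in Hc, M2.
  set (f := INR (length fs)) in *. set (k := INR c) in *.
  apply Rmult_le_reg_r with (k * (k - 1)); [nra|].
  replace (f * (1 - 2 / k) * (k * (k - 1))) with (f * (k - 2) * (k - 1)) by (field; lra).
  set (f' := INR (length fs')) in *.
  assert (A1 : INR m * (k - 1) <= f' * (k - 2)) by (replace (INR m) with (f' - INR n2) by lra; lra).
  assert (A2 : f' * k <= f * (k - 1)) by (replace f' with (f - INR n1) by lra; lra).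
  apply Rmult_le_compat_r with (r := k) in A1; [|lra].
  apply Rmult_le_compat_r with (r := k - 2) in A2; [|lra].
  lra.
Qed.

(** * The common orthogonal direction and the selection of guards *)

Lemma common_orthogonal v v' : exists e, e <> zero3 /\ dot3 v e = 0 /\ dot3 v' e = 0.
Proof.
  destruct (classic (cross3 v v' = zero3)) as [Z|N].
  - destruct (classic (v = zero3)) as [->|Nv].
    + destruct (classic (v' = zero3)) as [->|Nv'].
      * exists (mkR3 1 0 0). split; [intros E; injection E; lra|]. split; vec; ring.
      * destruct (plane_basis v' Nv') as (e & _ & Ne & _ & Oe & _).
        exists e. repeat split; auto. vec; ring.
    + destruct (plane_basis v Nv) as (e & _ & Ne & _ & Oe & _).
      exists e. repeat split; auto.
      assert (Pv := dot3_self_pos v Nv).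
      (* The Binet-Cauchy identity; with vanishing cross product it makes [e] orthogonal to [v'] as
         well. *)
      assert (L : dot3 v v * dot3 v' e = dot3 v v' * dot3 v e + dot3 (cross3 v v') (cross3 v e))
        by (unfold cross3; vec; ring).
      rewrite Z, Oe in L. replace (dot3 zero3 (cross3 v e)) with 0 in L by (vec; ring).
      assert (L' : dot3 v v * dot3 v' e = 0) by lra.
      apply Rmult_integral in L'. destruct L'; lra.
  - exists (cross3 v v'). repeat split; auto; unfold cross3; vec; ring.
Qed.

(** The face found by the ray argument is listed only up to [same_set], so its properties are moved
    to the listed copy. Conversely a visible point lies in [P], because outside the closed set [P]
    every point is exterior. *)
Lemma floors_guard P Cs e faces : cells_of P Cs -> e <> zero3 -> face_list P faces ->
  (forall g, In g (select (floor P e) faces) -> is_face P g) /\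
  guards P (fun x => exists g, In g (select (floor P e) faces) /\ g x) /\
  guards P (fun x => exists g, In g (select (floor P e) faces) /\ open_face g x).
Proof.
  intros HPC He [FL _].
  assert (Faces : forall g, In g faces -> is_face P g).
  { intros g Hg. apply FL. exists g. split; [exact Hg|]. intros x. reflexivity. }
  assert (Only : forall x y, visible P x y -> P y).
  { intros x y V. apply NNPP. intros N. apply (V y).
    - exists 1. split; [lra|]. apply R3_ext; vec; ring.
    - exact (cells_closed P Cs y HPC N). }
  assert (Seen : forall y, P y -> exists g x, In g (select (floor P e) faces) /\
                   open_face g x /\ visible P x y).
  { intros y Py. destruct (floor_point_seen P Cs e y HPC He Py) as (F & x & HF & Fl & Op & V).
    destruct (proj1 (FL F) HF) as (G & HG & Eq). exists G, x.
    assert (Rl : forall H u, relint H F u -> relint H G u).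
    { intros H u. apply relint_mono. intros w. apply Eq. }
    split; [apply in_select; split; [exact HG|]|split; [|exact V]].
    - destruct Fl as (n & u & r & Pe & Os & Fp & Ru). exists n, u, r.
      split; [exact Pe|]. split; [exact Os|]. split; [intros w Gw; apply Fp, Eq, Gw|auto].
    - destruct Op as (H & PH & FH & Rx). exists H. split; [exact PH|].
      split; [intros w Gw; apply FH, Eq, Gw|auto]. }
  split; [|split].
  - intros g Hg. apply in_select in Hg. apply Faces, Hg.
  - intros y. split; [|intros (x & _ & V); eauto].
    intros Py. destruct (Seen y Py) as (g & x & Hg & (H & _ & _ & Rx) & V).
    exists x. split; [exists g; split; [exact Hg|apply Rx]|exact V].
  - intros y. split; [|intros (x & _ & V); eauto].
    intros Py. destruct (Seen y Py) as (g & x & Hg & Op & V). eauto.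
Qed.

(** The length of [sel] is an integer, so the real inequality is equivalent to the bound by the
    integer part. *)
Theorem theorem1 (c : nat) (P : R3 -> Prop) (faces : list (R3 -> Prop)) :
  (3 <= c)%nat ->
  is_polyhedron P ->
  face_list P faces ->
  c_oriented c P ->
  (exists sel : list (R3 -> Prop),
      (forall g, In g sel -> is_face P g) /\
      INR (length sel) <= INR (length faces) / 2 - INR (length faces) / INR c /\
      guards P (fun x => exists g, In g sel /\ g x)) /\
  (exists sel : list (R3 -> Prop),
      (forall g, In g sel -> is_face P g) /\
      INR (length sel) <= INR (length faces) / 2 - INR (length faces) / INR c /\
      guards P (fun x => exists g, In g sel /\ open_face g x)).
Proof.
  intros Hc HP FL (vs & Lc & Unit & Orth).
  destruct (polyhedron_cells P HP) as (Cs & HPC). destruct HP as (_ & _ & M).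
  assert (Faces : forall g, In g faces -> is_face P g).
  { intros g Hg. apply FL. exists g. split; [exact Hg|]. intros x. reflexivity. }
  pose (rel (F : R3 -> Prop) v := forall p q, F p -> F q -> dot3 (sub3 p q) v = 0).
  destruct (two_popular rel c vs faces Lc ltac:(lia)) as (v & v' & Hv & Hv' & Few).
  { intros F HF. apply Orth. auto. }
  destruct (common_orthogonal v v') as (e & He & Oe & Oe').
  set (me := scale3 (-1) e).
  assert (Hme : me <> zero3).
  { intros Z. apply He. unfold me in Z. destruct e as [x y z]. unfold scale3, zero3 in Z.
    simpl in Z. injection Z. intros. apply R3_ext; simpl; lra. }
  assert (Count : (length (select (floor P e) faces) + length (select (floor P me) faces) <=
    length (select (fun f => ~ rel f v /\ ~ rel f v') faces))%nat).
  { apply length_select_disjoint.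
    - intros F HF. apply (floor_not_ceiling P Cs); auto.
    - assert (Om : dot3 v me = 0 /\ dot3 v' me = 0).
      { unfold me. rewrite !dot3_scale_r, Oe, Oe'. split; ring. }
      intros F HF [Fl|Fl]; split; intros Rv;
        [apply (floor_not_vertical _ _ _ v Fl)|apply (floor_not_vertical _ _ _ v' Fl)
        |apply (floor_not_vertical _ _ _ v Fl)|apply (floor_not_vertical _ _ _ v' Fl)];
        auto; tauto. }
  apply le_INR in Count. rewrite plus_INR in Count.
  assert (Hk : 0 < INR c) by (apply (lt_INR 0); lia).
  (* Written as twice the claimed bound, which the smaller of two families can then be measured
     against. *)
  replace (INR (length faces) * (1 - 2 / INR c))
    with (2 * (INR (length faces) / 2 - INR (length faces) / INR c)) in Few by (field; lra).
  assert (exists e', e' <> zero3 /\ INR (length (select (floor P e') faces)) <=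
     INR (length faces) / 2 - INR (length faces) / INR c) as (e' & He' & Half).
  { destruct (Rle_lt_dec (INR (length (select (floor P e) faces)))
      (INR (length (select (floor P me) faces)))); [exists e|exists me]; split; auto; lra. }
  destruct (floors_guard P Cs e' faces HPC He' FL) as (G1 & G2 & G3).
  split; exists (select (floor P e') faces); auto.
Qed.
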